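(* For every positive integer $j$, \begin{align*} \sum_{n=0}^{\infty}p_{-2}\left(5^{2j-1}n+\frac{7\cdot5^{2j-1}+1}{12}\right)q^{n}&=\sum_{l=1}^{\infty}a(2j-1,l)\,q^{l-1}\frac{E_{5}^{6l-2}}{E_{1}^{6l}},\\ \sum_{n=0}^{\infty}p_{-2}\left(5^{2j}n+\frac{11\cdot5^{2j}+1}{12}\right)q^{n}&=\sum_{l=1}^{\infty}a(2j,l)\,q^{l-1}\frac{E_{5}^{6l}}{E_{1}^{6l+2}}. \end{align*}
   Context: $\sum_{n\geq0}p_{-2}(n)q^n=\prod_{i\geq1}(1-q^i)^{-2}$ ($2$-colored partitions), and $E_j:=\prod_{n\geq1}(1-q^{jn})$. The integers $m(i,j)$ ($i,j\geq1$) are defined by: $m(1,1)=5$, $m(2,1)=10$, $m(3,1)=9$, $m(4,1)=4$, $m(5,1)=1$, $m(i,1)=0$ for $i\geq6$; and for $j\geq2$, $i\geq1$, $m(i,j)=25m(i-1,j-1)+25m(i-2,j-1)+15m(i-3,j-1)+5m(i-4,j-1)+m(i-5,j-1)$, with $m(i',j')=0$ whenever $i'\leq0$ (so $m(i,j)=0$ if $j>i$ or $i>5j$). The integers $a(j,k)$ ($j,k\geq1$) are defined by $a(1,1)=10$, $a(1,2)=125$, $a(1,k)=0$ for $k\geq3$, and $a(j+1,k)=\sum_{i\geq1}a(j,i)m(6i,i+k)$ if $j$ is odd, $a(j+1,k)=\sum_{i\geq1}a(j,i)m(6i+2,i+k)$ if $j$ is even (finite sums). *)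

(* Defs.v *)
From HB Require Import structures.
From mathcomp Require Import all_boot all_order all_algebra.
From mathcomp Require Import boolp classical_sets.
From mathcomp Require Import zify.

Set Implicit Arguments.
Unset Strict Implicit.
Unset Printing Implicit Defensive.

Import GRing.Theory.
Local Open Scope ring_scope.

(* Formal power series in q over R; coefs f n is the coefficient of q^n. *)
Record fps (R : Type) := Fps { coefs : nat -> R }.

Lemma fpsP (R : Type) (f g : fps R) : coefs f =1 coefs g -> f = g.
Proof. by case: f g => [f] [g] /= /funext->. Qed.

HB.instance Definition _ (R : Type) := gen_eqMixin (fps R).
HB.instance Definition _ (R : Type) := gen_choiceMixin (fps R).

Section FpsZmod.
Variable R : zmodType.
Implicit Types f g h : fps R.

Definition fps_zero : fps R := Fps (fun=> 0).
Definition fps_add f g : fps R := Fps (fun n => coefs f n + coefs g n).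
Definition fps_opp f : fps R := Fps (fun n => - coefs f n).

Fact fps_addA : associative fps_add.
Proof. by move=> f g h; apply: fpsP => n /=; rewrite addrA. Qed.
Fact fps_addC : commutative fps_add.
Proof. by move=> f g; apply: fpsP => n /=; rewrite addrC. Qed.
Fact fps_add0 : left_id fps_zero fps_add.
Proof. by move=> f; apply: fpsP => n /=; rewrite add0r. Qed.
Fact fps_addN : left_inverse fps_zero fps_opp fps_add.
Proof. by move=> f; apply: fpsP => n /=; rewrite addNr. Qed.

HB.instance Definition _ :=
  GRing.isZmodule.Build (fps R) fps_addA fps_addC fps_add0 fps_addN.

End FpsZmod.

Section FpsRing.
Variable R : comNzRingType.
Implicit Types f g h : fps R.

Definition fps_one : fps R := Fps (fun n => (n == 0)%:R).
Definition fps_mul f g : fps R :=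
  Fps (fun n => \sum_(i < n.+1) coefs f i * coefs g (n - i)).

Let trunc N f : {poly R} := \poly_(i < N) coefs f i.

Let coef_trunc N f n : (n < N)%N -> (trunc N f)`_n = coefs f n.
Proof. by move=> ltnN; rewrite coef_poly ltnN. Qed.

Let coefsM_trunc N f g n :
  (n < N)%N -> coefs (fps_mul f g) n = (trunc N f * trunc N g)`_n.
Proof.
move=> ltnN; rewrite coefM /=; apply: eq_bigr => i _.
rewrite !coef_trunc //; first exact: leq_ltn_trans (leq_subr _ _) ltnN.
exact: leq_ltn_trans (leq_ord i) ltnN.
Qed.

Fact fps_mulA : associative fps_mul.
Proof.
move=> f g h; apply: fpsP => n.
transitivity (trunc n.+1 f * (trunc n.+1 g * trunc n.+1 h))`_n.
  rewrite coefM /=; apply: eq_bigr => i _; congr (_ * _).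
    by rewrite coef_trunc.
  by rewrite -coefsM_trunc // ltnS leq_subr.
rewrite mulrA coefM /=; apply: eq_bigr => i _; congr (_ * _).
  by rewrite -coefsM_trunc.
by rewrite coef_trunc // ltnS leq_subr.
Qed.

Fact fps_mulC : commutative fps_mul.
Proof.
by move=> f g; apply: fpsP => n; rewrite !(coefsM_trunc _ _ (ltnSn n)) mulrC.
Qed.

Fact fps_mul1 : left_id fps_one fps_mul.
Proof.
move=> f; apply: fpsP => n /=; rewrite big_ord_recl /= mul1r subn0 big1 ?addr0 //.
by move=> i _; rewrite mul0r.
Qed.

Fact fps_mulDl : left_distributive fps_mul (@fps_add R).
Proof.
move=> f g h; apply: fpsP => n /=; rewrite -big_split /=.
by apply: eq_bigr => i _; rewrite mulrDl.
Qed.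

Fact fps_one_neq0 : fps_one != 0.
Proof. by apply/eqP => /(congr1 (fun f => coefs f 0))/eqP; rewrite oner_eq0. Qed.

HB.instance Definition _ := GRing.Zmodule_isComNzRing.Build (fps R)
  fps_mulA fps_mulC fps_mul1 fps_mulDl fps_one_neq0.

Definition fpsX : fps R := Fps (fun n => (n == 1)%:R).

Lemma coefs0 n : coefs (0 : fps R) n = 0. Proof. by []. Qed.

Lemma coefs1 n : coefs (1 : fps R) n = (n == 0)%:R. Proof. by []. Qed.

Lemma coefsD f g n : coefs (f + g) n = coefs f n + coefs g n.
Proof. by []. Qed.

Lemma coefsN f n : coefs (- f) n = - coefs f n. Proof. by []. Qed.

Lemma coefsB f g n : coefs (f - g) n = coefs f n - coefs g n.
Proof. by []. Qed.

Lemma coefsM f g n :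
  coefs (f * g) n = \sum_(i < n.+1) coefs f i * coefs g (n - i).
Proof. by []. Qed.

Lemma coefsXM f n :
  coefs (fpsX * f) n = if n is n'.+1 then coefs f n' else 0.
Proof.
rewrite coefsM; case: n => [|n]; first by rewrite big_ord1 mul0r.
rewrite big_ord_recl mul0r add0r big_ord_recl mul1r subSS subn0.
by rewrite big1 ?addr0 // => i _; rewrite mul0r.
Qed.

Lemma coefsXnM k f n :
  coefs (fpsX ^+ k * f) n = if (n < k)%N then 0 else coefs f (n - k).
Proof.
elim: k n => [|k IHk] n; first by rewrite expr0 mul1r subn0.
by rewrite exprS -mulrA coefsXM; case: n => [|n] //; rewrite IHk.
Qed.

Lemma coefsXn k n : coefs (fpsX ^+ k) n = (n == k)%:R.
Proof.
rewrite -[fpsX ^+ k]mulr1 coefsXnM coefs1 subn_eq0 eqn_leq.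
by case: (ltnP n k) => [_|_]; rewrite ?andbF ?andbT.
Qed.

End FpsRing.

Notation "''q'" := (@fpsX _) (at level 0) : ring_scope.

Section FpsUnit.
Variable R : comUnitRingType.
Implicit Types f g : fps R.

(* The first n + 1 coefficients g_0, ..., g_n of g = 1 / f, from f_0 g_0 = 1
   and f_0 g_n = - sum_(i < n) f_(n - i) g_i. *)
Fixpoint fps_inv_seq f n : seq R :=
  if n is n'.+1 then
    let s := fps_inv_seq f n' in
    rcons s (- (coefs f 0)^-1 * \sum_(i < n) coefs f (n - i) * s`_i)
  else [:: (coefs f 0)^-1].

Definition fps_unit : pred (fps R) := fun f => coefs f 0 \is a GRing.unit.

Definition fps_inv f : fps R :=
  if fps_unit f then Fps (fun n => (fps_inv_seq f n)`_n) else f.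

Let size_inv_seq f n : size (fps_inv_seq f n) = n.+1.
Proof. by elim: n => //= n IHn; rewrite size_rcons IHn. Qed.

Let nth_inv_seq f n i :
  (i <= n)%N -> (fps_inv_seq f n)`_i = (fps_inv_seq f i)`_i.
Proof.
elim: n => [|n IHn]; first by case: i.
rewrite leq_eqVlt => /orP[/eqP-> //|lein].
by rewrite /= nth_rcons size_inv_seq lein IHn.
Qed.

Fact fps_mulVr : {in fps_unit, left_inverse 1 fps_inv *%R}.
Proof.
move=> f fU; apply: fpsP => n; have f0U : coefs f 0 \is a GRing.unit := fU.
rewrite coefsM coefs1 /fps_inv [fps_unit f]fU /=; case: n => [|n].
  by rewrite big_ord1 mulVr.
rewrite big_ord_recr /= subnn nth_rcons size_inv_seq ltnn eqxx.
rewrite mulrAC mulNr mulVr // mulN1r; apply/eqP; rewrite subr_eq0; apply/eqP.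
by apply: eq_bigr => i _; rewrite mulrC [in RHS]nth_inv_seq ?leq_ord.
Qed.

Fact fps_unitP f g : g * f = 1 -> fps_unit f.
Proof.
move=> /(congr1 (fun h => coefs h 0)); rewrite coefsM big_ord1 coefs1 /= => gf1.
by rewrite /fps_unit; apply/unitrPr; exists (coefs g 0); rewrite mulrC.
Qed.

Fact fps_inv_out : {in [predC fps_unit], fps_inv =1 id}.
Proof.
by move=> f fU; rewrite /fps_inv ifF //; apply/negbTE; move: fU; rewrite inE.
Qed.

HB.instance Definition _ := GRing.ComNzRing_hasMulInverse.Build (fps R)
  fps_mulVr fps_unitP fps_inv_out.

Lemma fps_unitE f : (f \is a GRing.unit) = (coefs f 0 \is a GRing.unit).
Proof. by []. Qed.

End FpsUnit.

(* Convergence in the q-adic topology: every coefficient is eventually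
   constant. *)
Definition fps_cvg (R : Type) (u : nat -> fps R) (f : fps R) : Prop :=
  forall n, exists N, forall M, (N <= M)%N -> coefs (u M) n = coefs f n.

(* The limit of u, with the junk value 0 if u does not converge. *)
Definition fps_lim (R : zmodType) (u : nat -> fps R) : fps R :=
  xget 0 [set f | fps_cvg u f]%classic.

Lemma fps_cvg_unique (R : Type) (u : nat -> fps R) f g :
  fps_cvg u f -> fps_cvg u g -> f = g.
Proof.
move=> uf ug; apply: fpsP => n; have [[N1 uf1] [N2 ug2]] := (uf n, ug n).
by rewrite -(uf1 (maxn N1 N2)) ?leq_maxl // ug2 // leq_maxr.
Qed.

Lemma fps_cvg_lim (R : zmodType) (u : nat -> fps R) f :
  fps_cvg u f -> fps_lim u = f.
Proof.
by move=> uf; apply: xget_unique => // g ug; exact: fps_cvg_unique ug uf.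
Qed.

(* The infinite product of F i over i >= 1. *)
Definition fps_prod (R : comNzRingType) (F : nat -> fps R) : fps R :=
  fps_lim (fun N => \prod_(1 <= i < N.+1) F i).

Lemma fps_prod_cvg (R : comNzRingType) (F : nat -> fps R) :
  (forall i n, (n < i)%N -> coefs (F i) n = (n == 0)%:R) ->
  fps_cvg (fun N => \prod_(1 <= i < N.+1) F i) (fps_prod F).
Proof.
move=> F1; set u := fun N => _.
have step N n : (n <= N)%N -> coefs (u N.+1) n = coefs (u N) n.
  move=> lenN; rewrite /u big_nat_recr //= big_ord_recr /= subnn F1 //.
  rewrite mulr1 big1 ?add0r // => i _; rewrite F1.
    by rewrite subn_eq0 leqNgt ltn_ord mulr0.
  by rewrite ltnS (leq_trans (leq_subr _ _)).
have stab n M : (n <= M)%N -> coefs (u M) n = coefs (u n) n.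
  elim: M => [|M IHM]; first by rewrite leqn0 => /eqP->.
  by rewrite leq_eqVlt => /orP[/eqP-> //|lenM]; rewrite step // IHM.
have uf : fps_cvg u (Fps (fun n => coefs (u n) n)).
  by move=> n; exists n => M lenM; rewrite stab.
by rewrite /fps_prod (fps_cvg_lim uf).
Qed.

Definition E (j : nat) : fps int := fps_prod (fun n => 1 - 'q ^+ (j * n)).

Lemma E_cvg j : (0 < j)%N ->
  fps_cvg (fun N => \prod_(1 <= n < N.+1) (1 - 'q ^+ (j * n))) (E j).
Proof.
move=> j0; apply: fps_prod_cvg => i n ltni.
rewrite coefsB coefs1 coefsXn [n == _ * _]ltn_eqF ?subr0 //.
by rewrite (leq_trans ltni) // leq_pmull.
Qed.

Lemma E_unit j : (0 < j)%N -> E j \is a GRing.unit.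
Proof.
move=> j0; have [N /(_ N (leqnn N)) EN] := E_cvg j0 0.
rewrite fps_unitE -EN big_nat.
elim/big_rec: _ => [|i f /andP[i0 _] fU]; first exact: unitr1.
rewrite coefsM big_ord1 subn0 coefsB coefs1 coefsXn [(0 == j * i)%N]ltn_eqF ?muln_gt0 ?j0 //.
by rewrite subr0 mul1r.
Qed.

(* p_{-2}(n), the number of 2-coloured partitions of n. *)
Definition p2 (n : nat) : int :=
  coefs (fps_prod (fun i => (1 - 'q ^+ i) ^- 2)) n.

Lemma p2_cvg :
  fps_cvg (fun N => \prod_(1 <= i < N.+1) (1 - 'q ^+ i) ^- 2) (Fps p2).
Proof.
suff F1 i n : (n < i)%N -> coefs ((1 - 'q ^+ i) ^- 2 : fps int) n = (n == 0)%:R.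
  by have := fps_prod_cvg F1; congr (fps_cvg _ _); apply: fpsP.
move=> ltni; have i0 : (0 < i)%N by apply: leq_ltn_trans ltni.
have : (1 - 'q ^+ i) ^+ 2 = 1 + 'q ^+ i * ('q ^+ i - 2%:R) :> fps int.
  by rewrite -opprB sqrrN sqrrB1 mulrBr -expr2 mulr_natr addrC.
move: ('q ^+ i - 2%:R) (_ ^+ 2) => g f fE.
have fU : f \is a GRing.unit.
  by rewrite fps_unitE fE coefsD coefsXnM i0 addr0 coefs1.
have -> : f^-1 = 1 - 'q ^+ i * (g * f^-1).
  by apply: (mulIr fU); rewrite mulrA mulVr // mulrBl mul1r divrK // fE addrK.
by rewrite coefsB coefsXnM ltni subr0 coefs1.
Qed.

(* Truncated subtraction and m 0 j = 0 implement the convention that m(i', j')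
   vanishes for i' <= 0. *)
Fixpoint m (i j : nat) : int :=
  match i, j with
  | 0, _ | _, 0 => 0
  | _, 1 => [:: 0; 5; 10; 9; 4; 1]`_i
  | _, j'.+1 => 25 * m (i - 1) j' + 25 * m (i - 2) j' + 15 * m (i - 3) j'
                + 5 * m (i - 4) j' + m (i - 5) j'
  end.

Lemma m_eq0 i j : (i < j)%N || (5 * j < i)%N -> m i j = 0.
Proof.
elim: j i => [|j IHj] [|i] // ij; case: j IHj ij => [|j] IHj ij.
  by case: i ij => [|[|[|[|[|i]]]]] //= _; rewrite nth_nil.
have {}IHj k : (0 < k <= 5)%N -> m (i.+1 - k) j.+1 = 0.
  move=> k5; case ik: (i.+1 - k)%N => [|d] //.
  by rewrite -ik; apply: IHj; lia.
by rewrite -[LHS]/(25 * m (i.+1 - 1) j.+1 + 25 * m (i.+1 - 2) j.+1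
  + 15 * m (i.+1 - 3) j.+1 + 5 * m (i.+1 - 4) j.+1 + m (i.+1 - 5) j.+1) !IHj.
Qed.

(* The sum over i >= 1 is cut at i = 5k: the omitted terms vanish because
   6i > 5(i + k); see a_rec. *)
Fixpoint a (j k : nat) : int :=
  match j with
  | 0 => 0
  | 1 => [:: 0; 10; 125]`_k
  | j'.+1 => \sum_(1 <= i < (5 * k).+1)
               a j' i * m (if odd j' then 6 * i else 6 * i + 2)%N (i + k)
  end.

Lemma a_rec j k N : (0 < j)%N -> (5 * k <= N)%N ->
  a j.+1 k = \sum_(1 <= i < N.+1)
               a j i * m (if odd j then 6 * i else 6 * i + 2)%N (i + k).
Proof.
case: j => // j _ kN; rewrite (@big_cat_nat _ _ _ (5 * k).+1) //=.
rewrite [X in _ = _ + X]big_nat [X in _ = _ + X]big1 ?addr0 // => i ki.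
by rewrite m_eq0 ?mulr0 //; case: ifP => _; lia.
Qed.

(* The divisions by 12 in the arguments of p2 are exact. *)
Lemma dvd12_odd j : (0 < j)%N -> (12 %| 7 * 5 ^ (2 * j - 1) + 1)%N.
Proof.
case: j => // j _; have -> : (2 * j.+1 - 1 = (2 * j).+1)%N by lia.
rewrite expnS expnM.
have : (5 ^ 2) ^ j = 1 %[mod 12] by rewrite -modnXm exp1n.
by move: (_ ^ j)%N => x; lia.
Qed.

Lemma dvd12_even j : (12 %| 11 * 5 ^ (2 * j) + 1)%N.
Proof.
rewrite expnM; have : (5 ^ 2) ^ j = 1 %[mod 12] by rewrite -modnXm exp1n.
by move: (_ ^ j)%N => x; lia.
Qed.

(* Main.v *)
From HB Require Import structures.
Require Import Defs.
From mathcomp Require Import all_boot all_order all_algebra.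
From mathcomp Require Import algC cyclotomic zify ring.

(* Write U for the operator sum f_n q^n |-> sum f_(5n) q^n.  Euler's pentagonal
   number theorem splits E_1 modulo 5 as A - C - B with C = q E_25 and A, B
   supported on exponents congruent to 0 and 2.  By Jacobi's identity E_1^3 has
   no exponent congruent to 2, which forces A B = C^2.  Multiplying the
   conjugates of E_1 under q |-> w q (w^5 = 1) then gives
   A^5 - 11 C^5 - B^5 = E_5^6 / E_25, which is an equation of degree 5 for
   x = C / E_1.  Applying U to it yields
   U(x^i) = sum_j m(i,j) tau^j with tau = q E_5^6 / E_1^6, and the theorem
   follows by induction, since each generating function is, up to a factor
   q E_5^2 or q E_1^2, the polynomial sum_l a(j,l) tau^l. *)

Set Implicit Arguments.
Unset Strict Implicit.
Unset Printing Implicit Defensive.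

Import GRing.Theory.
Local Open Scope ring_scope.

(** * q-adic convergence and quinary sections *)

Section Convergence.
Variable R : comNzRingType.
Implicit Types (f g : fps R) (u v : nat -> fps R).

Lemma fps_cvg_cst f : fps_cvg (fun=> f) f.
Proof. by move=> n; exists 0. Qed.

Lemma fps_cvgM u v f g :
  fps_cvg u f -> fps_cvg v g -> fps_cvg (fun N => u N * v N) (f * g).
Proof.
have unif (w : nat -> fps R) h : fps_cvg w h -> forall n, exists N, forall M, (N <= M)%N ->
    forall i, (i <= n)%N -> coefs (w M) i = coefs h i.
  move=> wh; elim=> [|n [N IH]].
    by have [N wN] := wh 0; exists N => M NM i; rewrite leqn0 => /eqP->; apply: wN.
  have [N' wN'] := wh n.+1; exists (maxn N N') => M; rewrite geq_max.
  case/andP=> NM N'M i; rewrite leq_eqVlt => /orP[/eqP->|]; first exact: wN'.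
  by rewrite ltnS; apply: IH.
move=> /unif uf /unif vg n; have [[N1 H1] [N2 H2]] := (uf n, vg n).
exists (maxn N1 N2) => M; rewrite geq_max => /andP[M1 M2].
rewrite !coefsM; apply: eq_bigr => i _.
by rewrite H1 ?H2 // ?leq_subr // -ltnS.
Qed.

Lemma fps_cvgX u f n : fps_cvg u f -> fps_cvg (fun N => u N ^+ n) (f ^+ n).
Proof.
move=> uf; elim: n => [|n IHn]; first exact: fps_cvg_cst.
rewrite exprS => k; have [N HN] := fps_cvgM uf IHn k; exists N => M NM.
by rewrite exprS HN.
Qed.

Lemma fps_cvg_sub u f (phi : nat -> nat) :
  (forall n, (n <= phi n)%N) -> fps_cvg u f -> fps_cvg (u \o phi) f.
Proof.
move=> lephi uf n; have [N HN] := uf n; exists N => M NM /=.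
by apply: HN; apply: leq_trans NM (lephi M).
Qed.

Lemma eq_fps_cvg u v f : u =1 v -> fps_cvg u f -> fps_cvg v f.
Proof. by move=> uv uf n; have [N HN] := uf n; exists N => M /HN; rewrite uv. Qed.

Definition fps_eqm (N : nat) f g := forall n, (n < N)%N -> coefs f n = coefs g n.

Lemma fps_eqm_refl N f : fps_eqm N f f. Proof. by []. Qed.

Lemma fps_eqm_sym N f g : fps_eqm N f g -> fps_eqm N g f.
Proof. by move=> fg n /fg. Qed.

Lemma fps_eqm_trans N f g h : fps_eqm N f g -> fps_eqm N g h -> fps_eqm N f h.
Proof. by move=> fg gh n nN; rewrite fg ?gh. Qed.

Lemma fps_eqmW N M f g : (N <= M)%N -> fps_eqm M f g -> fps_eqm N f g.
Proof. by move=> NM fg n nN; apply: fg; apply: leq_trans NM. Qed.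

Lemma fps_eqmD N f f' g g' :
  fps_eqm N f f' -> fps_eqm N g g' -> fps_eqm N (f + g) (f' + g').
Proof. by move=> ff gg n nN; rewrite !coefsD ff ?gg. Qed.

Lemma fps_eqmM N f f' g g' :
  fps_eqm N f f' -> fps_eqm N g g' -> fps_eqm N (f * g) (f' * g').
Proof.
move=> ff gg n nN; rewrite !coefsM; apply: eq_bigr => i _.
rewrite ff ?gg //; first exact: leq_ltn_trans (leq_subr _ _) nN.
by apply: leq_ltn_trans nN; rewrite -ltnS.
Qed.

Lemma fps_eqm_sum N (I : finType) (F G : I -> fps R) :
  (forall i, fps_eqm N (F i) (G i)) -> fps_eqm N (\sum_i F i) (\sum_i G i).
Proof.
move=> FG; apply: (big_ind2 (fps_eqm N)) => //; first exact: fps_eqmD.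
Qed.

Lemma fps_eqm_Xn N k f : (N <= k)%N -> fps_eqm N ('q ^+ k * f) 0.
Proof. by move=> Nk n nN; rewrite coefsXnM (leq_trans nN Nk). Qed.

Lemma fps_eqm_cvg u f : (forall N, fps_eqm N.+1 (u N) f) -> fps_cvg u f.
Proof. by move=> uf n; exists n => M nM; apply: uf. Qed.

End Convergence.

(** The series q is not a unit, so its powers are cancelled by shifting coefficients. *)
Lemma mulXfI (R : comNzRingType) k : injective (fun f : fps R => 'q ^+ k * f).
Proof.
move=> f g /(congr1 (@coefs R)) fg; apply: fpsP => n.
have := congr1 (@^~ (n + k)%N) fg.
by rewrite !coefsXnM ltnNge leq_addl /= addnK.
Qed.

Section QuinarySections.
Variable R : comNzRingType.
Implicit Types f g : fps R.

(** The case r = 0 is the operator U. *)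
Definition sect (r : nat) f : fps R := Fps (fun n => coefs f (5 * n + r)).

Definition subst5 f : fps R :=
  Fps (fun n => if (5 %| n)%N then coefs f (n %/ 5) else 0).

Lemma sectP f g : (forall r, (r < 5)%N -> sect r f = sect r g) -> f = g.
Proof.
move=> fg; apply: fpsP => n.
have n5 : (n %% 5 < 5)%N by rewrite ltn_mod.
have := congr1 (fun h => coefs h (n %/ 5)) (fg _ n5).
by rewrite /= mulnC -divn_eq.
Qed.

Fact sect_is_additive r : additive (sect r).
Proof. by move=> f g; apply: fpsP. Qed.
HB.instance Definition _ r := GRing.isZmodMorphism.Build _ _ (sect r) (sect_is_additive r).

Lemma sect_subst5 r f : (r < 5)%N -> sect r (subst5 f) = if r == 0 then f else 0.
Proof.
move=> r5; apply: fpsP => n /=; rewrite dvdn_addr ?dvdn_mulr //.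
case: eqP => [->|/eqP r0]; first by rewrite dvdn0 addn0 mulKn.
by rewrite gtnNdvd // lt0n.
Qed.

Lemma sum_dvd5 (F : nat -> R) r n : (r < 5)%N ->
    (forall i, ~~ (5 %| i)%N -> F i = 0) ->
  \sum_(i < (5 * n + r).+1) F i = \sum_(i < n.+1) F (5 * i)%N.
Proof.
move=> r5 F0; elim: n => [|n IHn].
  rewrite muln0 add0n big_ord_recl big_ord1 muln0 big1 ?addr0 // => i _.
  by rewrite F0 // gtnNdvd //= (leq_ltn_trans _ r5) // /bump /= add1n.
have -> : (5 * n.+1 + r).+1 = ((5 * n + r).+1 + 5)%N by lia.
rewrite big_split_ord /= IHn [RHS]big_ord_recr; congr (_ + _).
have r5' : (4 - r < 5)%N by lia.
rewrite (bigD1 (Ordinal r5')) //= big1 ?addr0 => [|i]; first by congr F; lia.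
rewrite -val_eqE /= => ir; have i5 := ltn_ord i; apply: F0; lia.
Qed.

(** Only exponents of [subst5 f] divisible by 5 enter the Cauchy product, so a series in q^5 leaves
    each section as the same series in q. All later computations with U rest on this linearity. *)
Lemma sectVM r f g : (r < 5)%N -> sect r (subst5 f * g) = f * sect r g.
Proof.
move=> r5; apply: fpsP => n /=.
rewrite (@sum_dvd5 (fun i => (if (5 %| i)%N then coefs f (i %/ 5) else 0)
                              * coefs g (5 * n + r - i))) //; last first.
  by move=> i /negbTE->; rewrite mul0r.
apply: eq_bigr => i _; rewrite dvdn_mulr // mulKn //; congr (_ * coefs g _).
by have := ltn_ord i; lia.
Qed.

Fact subst5_is_additive : additive subst5.
Proof. by move=> f g; apply: fpsP => n /=; case: ifP; rewrite ?subr0. Qed.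
HB.instance Definition _ := GRing.isZmodMorphism.Build _ _ subst5 subst5_is_additive.

Fact subst5_is_monoid_morphism : monoid_morphism subst5.
Proof.
split=> [|f g].
  apply: fpsP => n /=; case: ifP => [/dvdnP[k ->]|]; last by case: n.
  by rewrite mulnK // muln_eq0 orbF.
apply: sectP => r r5; rewrite sectVM // !sect_subst5 //.
by case: eqP; rewrite ?mulr0.
Qed.
HB.instance Definition _ := GRing.isMonoidMorphism.Build _ _ subst5 subst5_is_monoid_morphism.

Lemma subst5X : subst5 'q = 'q ^+ 5.
Proof.
apply: fpsP => n; rewrite coefsXn /=; case: ifP => [/dvdnP[k ->]|]; rewrite ?mulnK //.
  by congr (_%:R); lia.
by case: eqP => // ->.
Qed.

Lemma sectXn r k : (r < 5)%N ->
  sect r ('q ^+ k) = if (k %% 5 == r)%N then 'q ^+ (k %/ 5) else 0.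
Proof.
move=> r5; apply: fpsP => n; rewrite /= coefsXn; case: ifP => kr; rewrite ?coefsXn.
  by congr (_%:R); lia.
by rewrite (_ : _ == _ = false) //; lia.
Qed.

Lemma subst5_cvg (u : nat -> fps R) f :
  fps_cvg u f -> fps_cvg (subst5 \o u) (subst5 f).
Proof.
move=> uf n; have [N HN] := uf (n %/ 5)%N; exists N => M NM /=.
by case: ifP; rewrite ?HN.
Qed.

Lemma sect_cvg r (u : nat -> fps R) f :
  fps_cvg u f -> fps_cvg (sect r \o u) (sect r f).
Proof. by move=> uf n; have [N HN] := uf (5 * n + r)%N; exists N => M NM /=; apply: HN. Qed.

Lemma sect_one r : (r < 5)%N -> sect r (1 : fps R) = (r == 0)%:R.
Proof. by move=> r5; rewrite -(expr0 'q) sectXn // eq_sym; case: eqP. Qed.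

End QuinarySections.

Lemma subst5E j : (0 < j)%N -> subst5 (E j) = E (5 * j).
Proof.
move=> j0; apply: fps_cvg_unique (subst5_cvg (E_cvg j0)) _.
have j50 : (0 < 5 * j)%N by rewrite muln_gt0.
apply: eq_fps_cvg (E_cvg j50) => N /=; rewrite rmorph_prod; apply: eq_bigr => n _.
by rewrite rmorphB rmorph1 rmorphXn /= subst5X -exprM mulnA.
Qed.

(** The finite q-Pochhammer symbol (q;q)_n. *)
Definition pochq (n : nat) : fps int := \prod_(1 <= i < n.+1) (1 - 'q ^+ i).

Lemma pochq0 : pochq 0 = 1. Proof. by rewrite /pochq big_geq. Qed.

Lemma pochqS n : pochq n.+1 = pochq n * (1 - 'q ^+ n.+1).
Proof. by rewrite /pochq big_nat_recr. Qed.

Lemma pochq_unit n : pochq n \is a GRing.unit.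
Proof.
elim: n => [|n IHn]; first by rewrite pochq0 unitr1.
rewrite pochqS unitrM IHn fps_unitE coefsB coefs1 coefsXn subr0.
exact: unitr1.
Qed.

Lemma pochq_cvg : fps_cvg pochq (E 1).
Proof.
apply: eq_fps_cvg (@E_cvg 1 isT) => N.
by apply: eq_bigr => n _; rewrite mul1n.
Qed.

Lemma pochq_eqmE n : fps_eqm n.+1 (pochq n) (E 1).
Proof.
have stab M : (n <= M)%N -> fps_eqm n.+1 (pochq M) (pochq n).
  elim: M => [|M IHM]; first by rewrite leqn0 => /eqP->.
  rewrite leq_eqVlt => /orP[/eqP-> //|nM]; apply: fps_eqm_trans (IHM nM).
  rewrite pochqS -[X in fps_eqm _ _ X]addr0 mulrBr mulr1.
  apply: fps_eqmD; first exact: fps_eqm_refl.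
  by rewrite mulrC -mulrN; apply: fps_eqm_Xn.
move=> k kn; have [N HN] := pochq_cvg k.
rewrite -(HN (maxn n N)) ?leq_maxr //.
by rewrite (stab (maxn n N)) ?leq_maxl.
Qed.

(** * Euler's pentagonal number theorem modulo 5 *)

Lemma bin2S n : 'C(n.+1, 2) = ('C(n, 2) + n)%N.
Proof. by rewrite binS bin1 addnC addnC. Qed.

Lemma bin2_mul5D k r :
  'C(5 * k + r, 2) = (25 * 'C(k, 2) + 10 * k + 5 * k * r + 'C(r, 2))%N.
Proof.
elim: r => [|r IHr]; last by rewrite addnS !bin2S IHr; lia.
rewrite muln0 bin0n !addn0; elim: k => [|k IHk] //.
have -> : (5 * k.+1 = (5 * k).+4.+1)%N by lia.
by rewrite !bin2S IHk; lia.
Qed.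

(** The pentagonal number s(3s-1)/2, written without division; its companion s(3s+1)/2 is
    [pent s + s]. *)
Definition pent (s : nat) : nat := (3 * 'C(s, 2) + s)%N.

Definition pent_sum (N : nat) : fps int :=
  1 + \sum_(1 <= s < N.+1) (-1) ^+ s * ('q ^+ pent s + 'q ^+ (pent s + s)).

Lemma pent_sumS N : pent_sum N.+1 =
  pent_sum N + (-1) ^+ N.+1 * ('q ^+ pent N.+1 + 'q ^+ (pent N.+1 + N.+1)).
Proof. by rewrite /pent_sum big_nat_recr //= addrA. Qed.

(* Shanks' finite form of Euler's pentagonal number theorem. *)
Lemma pent_sum_shanks N : pent_sum N =
  \sum_(s < N.+1) (-1) ^+ s * (pochq N / pochq s) * 'q ^+ (s * N + 'C(s.+1, 2)).
Proof.
have pV s : pochq s * (pochq s)^-1 = 1 by rewrite mulrV ?pochq_unit.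
elim: N => [|n IHn].
  by rewrite /pent_sum big_geq // big_ord1 /= pV expr0 mul0n !mul1r addr0.
pose F n s : fps int := (-1) ^+ s * (pochq n / pochq s) * 'q ^+ (s * n + 'C(s.+1, 2)).
(* The change from n to n+1 telescopes in s. At K = n the closed form is the new term of exponent
   [pent n.+1]; the extra summand s = n+1 is its companion. *)
have tele K : \sum_(s < K.+1) (F n.+1 s - F n s) =
    (-1) ^+ K.+1 * (pochq n / pochq K) * 'q ^+ (K.+1 * n.+1 + 'C(K.+1, 2)).
  elim: K => [|K IHK].
    rewrite big_ord1 /F !mul0n mul1n /= bin_small // expr0 expr1 addn0 pochqS pochq0.
    by rewrite invr1 addn0; move: (_ ^+ n.+1) => x; ring.
  rewrite big_ord_recr /= IHK /F.
  have -> : pochq n / pochq K = (pochq n / pochq K.+1) * (1 - 'q ^+ K.+1).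
    rewrite pochqS invrM ?unitrM; last 2 first.
    - exact: pochq_unit.
    - by have := pochq_unit K.+1; rewrite pochqS unitrM => /andP[].
    rewrite mulrA mulrAC divrK //.
    by have := pochq_unit K.+1; rewrite pochqS unitrM => /andP[].
  rewrite (pochqS n); move: (pochq n) (pochq K.+1)^-1 => p r.
  have -> : 'q ^+ (K.+1 * n.+1 + 'C(K.+1, 2)) = 'q ^+ (K.+1 * n + 'C(K.+1, 2)) * 'q ^+ K.+1 :> fps int.
    by rewrite -exprD; congr (_ ^+ _); lia.
  have -> : 'q ^+ (K.+1 * n.+1 + 'C(K.+2, 2)) =
    'q ^+ (K.+1 * n + 'C(K.+1, 2)) * 'q ^+ K.+1 * 'q ^+ K.+1 :> fps int.
    by rewrite -!exprD; congr (_ ^+ _); rewrite bin2S; lia.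
  have -> : 'q ^+ (K.+1 * n + 'C(K.+2, 2)) =
    'q ^+ (K.+1 * n + 'C(K.+1, 2)) * 'q ^+ K.+1 :> fps int.
    by rewrite -!exprD; congr (_ ^+ _); rewrite bin2S; lia.
  have -> : 'q ^+ (K.+2 * n.+1 + 'C(K.+2, 2)) =
    'q ^+ (K.+1 * n + 'C(K.+1, 2)) * 'q ^+ K.+1 * 'q ^+ K.+1 * 'q ^+ n.+1 :> fps int.
    by rewrite -!exprD; congr (_ ^+ _); rewrite bin2S; lia.
  move: ('q ^+ (K.+1 * n + _)) ('q ^+ K.+1) ('q ^+ n.+1) => y z x.
  by rewrite (exprS _ K.+1); ring.
rewrite pent_sumS IHn [RHS]big_ord_recr /=.
move: (tele n); rewrite sumrB /F => /eqP; rewrite subr_eq => /eqP->.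
rewrite !pV !mulr1 [RHS]addrAC addrC -mulrDr.
have b2 : (2 * 'C(n.+1, 2) = n.+1 * n)%N by elim: (n) => // k IHk; rewrite bin2S; lia.
by congr (_ + _ * (_ ^+ _ + _ ^+ _)); rewrite /pent ?(bin2S n.+1); lia.
Qed.

(** In Shanks' form the term s = 0 is [pochq N], and every other exponent s N + s(s+1)/2 exceeds
    N. *)
Lemma pent_sum_cvg : fps_cvg pent_sum (E 1).
Proof.
apply: fps_eqm_cvg => N; apply: fps_eqm_trans (@pochq_eqmE N).
rewrite pent_sum_shanks big_ord_recl /= mul0n bin_small // pochq0 expr0 invr1 !(mulr1, mul1r).
rewrite -[X in fps_eqm _ _ X]addr0; apply: fps_eqmD; first exact: fps_eqm_refl.
rewrite [X in fps_eqm _ _ X](_ : 0 = \sum_(s < N) 0); last by rewrite big1.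
apply: fps_eqm_sum => s; rewrite mulrC; apply: fps_eqm_Xn.
by rewrite /bump /= add1n !bin2S; nia.
Qed.

(** The numbers s(3s-1)/2 and s(3s+1)/2 leave only the residues 0, 1 and 2 modulo 5. *)
Lemma sect_pent_sum_eq0 r N : (2 < r < 5)%N -> sect r (pent_sum N) = 0.
Proof.
case/andP=> r2 r5; rewrite raddfD /= sect_one // [r == 0](_ : _ = false) ?add0r; last by case: r r2 r5.
rewrite raddf_sum /= big1 // => s _; rewrite -signr_odd.
suff H e : (e %% 5 <= 2)%N -> sect r ('q ^+ e : fps int) = 0.
  have [es eS] : (pent s %% 5 <= 2)%N /\ ((pent s + s) %% 5 <= 2)%N.
    have sE : s = (5 * (s %/ 5) + s %% 5)%N by rewrite mulnC -divn_eq.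
    move: (ltn_pmod s (isT : 0 < 5)%N).
    rewrite /pent; move: (s %/ 5)%N (s %% 5)%N sE => k t -> t5; rewrite bin2_mul5D.
    by move: 'C(k, 2) => b; case: t t5 => [|[|[|[|[|]]]]] // _; rewrite !bin2 /=; lia.
  by case: odd; rewrite ?expr1 ?expr0 ?mulN1r ?mul1r ?raddfN raddfD /= !H ?addr0 ?oppr0.
by move=> e2; rewrite sectXn // (_ : _ == _ = false) //; lia.
Qed.

(** For s in Z, s(3s-1)/2 is 1 modulo 5 exactly when s = 5t+1; it is then 25 t(3t+1)/2 + 1, with
    sign -(-1)^t, so Euler's series reappears. The cut at 5N+1 fits because, among the next five
    indices, 5N+4 and 5N+6 supply the pair t = -(N+1), N+1 and the others nothing. *)
Lemma sect1_pent_sum N : sect 1 (pent_sum (5 * N).+1) = - subst5 (pent_sum N).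
Proof.
have sectD f g : sect 1 (f + g : fps int) = sect 1 f + sect 1 g by exact: raddfD.
have s1 k e1 e2 : sect 1 ((-1) ^+ k * ('q ^+ e1 + 'q ^+ e2) : fps int) =
    (-1) ^+ k * (sect 1 ('q ^+ e1) + sect 1 ('q ^+ e2)).
  rewrite -signr_odd -[in RHS]signr_odd -sectD.
  by case: (odd k); rewrite ?expr1 ?expr0 ?mulN1r ?mul1r //; apply: raddfN.
elim: N => [|N IHN].
  rewrite muln0 pent_sumS sectD s1 /pent_sum !big_geq // addr0 sect_one // !sectXn //.
  by rewrite rmorph1 /= expr0 expr1 addr0 mulr1 add0r.
have -> : (5 * N.+1 = (5 * N).+4.+1)%N by lia.
rewrite (pent_sumS (5 * N).+4.+1) (pent_sumS (5 * N).+4) (pent_sumS (5 * N).+3).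
rewrite (pent_sumS (5 * N).+2) (pent_sumS (5 * N).+1).
rewrite 5!sectD IHN !s1 pent_sumS.
have pE r : pent (5 * N + r) = (5 * (15 * 'C(N, 2) + 7 * N + 3 * N * r) + (3 * 'C(r, 2) + r))%N.
  by rewrite /pent bin2_mul5D; lia.
have p1E : pent N.+1 = (3 * 'C(N, 2) + 4 * N + 1)%N by rewrite /pent bin2S; lia.
have sect1D e r : sect 1 ('q ^+ (5 * e + r) : fps int) =
    if (r %% 5 == 1)%N then 'q ^+ (e + r %/ 5) else 0.
  by rewrite sectXn // mulnC modnMDl divnMDl.
have -> : (5 * N).+4.+2 = (5 * N + 6)%N by lia.
have -> : (5 * N).+4.+1 = (5 * N + 5)%N by lia.
have -> : (5 * N).+4 = (5 * N + 4)%N by lia.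
have -> : (5 * N).+3 = (5 * N + 3)%N by lia.
have -> : (5 * N).+2 = (5 * N + 2)%N by lia.
have sect1p r : (0 < r)%N -> sect 1 ('q ^+ pent (5 * N + r) : fps int) =
    if ((3 * 'C(r, 2) + r) %% 5 == 1)%N
    then 'q ^+ (15 * 'C(N, 2) + 7 * N + 3 * N * r + (3 * 'C(r, 2) + r) %/ 5) else 0.
  by rewrite pE sect1D.
have sect1p' r : (0 < r)%N -> sect 1 ('q ^+ (pent (5 * N + r) + (5 * N + r)) : fps int) =
    if ((3 * 'C(r, 2) + r + r) %% 5 == 1)%N
    then 'q ^+ (15 * 'C(N, 2) + 8 * N + 3 * N * r + (3 * 'C(r, 2) + r + r) %/ 5) else 0.
  rewrite -sect1D pE.
  suff -> : (5 * (15 * 'C(N, 2) + 7 * N + 3 * N * r) + (3 * 'C(r, 2) + r) + (5 * N + r) =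
     5 * (15 * 'C(N, 2) + 8 * N + 3 * N * r) + (3 * 'C(r, 2) + r + r))%N by [].
  lia.
rewrite !sect1p // !sect1p' // p1E; move: 'C(N, 2) => b; rewrite !bin2 /=.
have sgn r : (-1) ^+ (5 * N + r) = (-1) ^+ (N + r) :> fps int.
  by rewrite -signr_odd -[RHS]signr_odd (oddD (5 * N)) (oddD N) oddM.
have s5 f k e1 e2 : subst5 (f + (-1) ^+ k * ('q ^+ e1 + 'q ^+ e2)) =
    subst5 f + (-1) ^+ k * ('q ^+ (5 * e1) + 'q ^+ (5 * e2)) :> fps int.
  rewrite rmorphD /= [in LHS]rmorphM /= rmorphD /= !rmorphXn /= rmorphN1 subst5X.
  by rewrite -!exprM.
rewrite !sgn !addr0 !mulr0 !addr0 add0r s5 opprD -addrA -mulNr; congr (_ + _).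
have -> : - (-1) ^+ N.+1 = (-1) ^+ N :> fps int by rewrite exprS mulN1r opprK.
have -> : (-1) ^+ (N + 4) = (-1) ^+ N :> fps int.
  by rewrite -signr_odd -[RHS]signr_odd oddD addbF.
have -> : (-1) ^+ (N + 6) = (-1) ^+ N :> fps int.
  by rewrite -signr_odd -[RHS]signr_odd oddD addbF.
by rewrite -mulrDr; congr (_ * (_ ^+ _ + _ ^+ _)); lia.
Qed.

(** The sections are limits of those of [pent_sum]: section 1 is [- E 5], and sections 3 and 4
    vanish. The last term is -B in the notation A - C - B. *)
Lemma E1_dissection : E 1 =
  subst5 (sect 0 (E 1)) - 'q * subst5 (E 5) + 'q ^+ 2 * subst5 (sect 2 (E 1)).
Proof.
have S1 : sect 1 (E 1) = - E 5.
  have lt5 : forall n, (n <= (5 * n).+1)%N by lia.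
  apply: fps_cvg_unique (sect_cvg 1 (fps_cvg_sub lt5 pent_sum_cvg)) _.
  rewrite -(@subst5E 1) // => n.
  have [M HM] := subst5_cvg pent_sum_cvg n; exists M => N MN.
  rewrite -[LHS]/(coefs (sect 1 (pent_sum (5 * N).+1)) n) sect1_pent_sum.
  by rewrite !coefsN -(HM _ MN).
have S34 r : (2 < r < 5)%N -> sect r (E 1) = 0.
  move=> r25; apply: fps_cvg_unique (sect_cvg r pent_sum_cvg) _.
  by apply: eq_fps_cvg (fps_cvg_cst 0) => N /=; rewrite sect_pent_sum_eq0.
apply: sectP => r r5.
have sectD f g : sect r (f + g : fps int) = sect r f + sect r g by exact: raddfD.
rewrite !sectD -mulNr !(mulrC _ (subst5 _)) -[subst5 (sect 0 _)]mulr1 !sectVM //.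
rewrite raddfN /= -['q]expr1 !sectXn // sect_one //.
case: r r5 sectD => [|[|[|[|[|]]]]] // _ _ /=.
- by rewrite oppr0 !mulr0 !addr0 mulr1.
- by rewrite S1 expr0 !mulr0 add0r mulrN1 addr0.
- by rewrite oppr0 !mulr0 !add0r expr0 mulr1.
- by rewrite S34 // oppr0 !mulr0 !addr0.
- by rewrite S34 // oppr0 !mulr0 !addr0.
Qed.

(** * Jacobi's identity for the cube of Euler's product *)

(* (-1)^k q^(k(k+1)/2) times the q-binomial coefficient [2n+1, n-k]: the
   coefficients of z^-k in (1 - z) prod_(1 <= i <= n) (1 - z q^i) (1 - q^i / z), which
   are antisymmetric under k <-> -1-k. *)
Fixpoint jacobi_coef (n k : nat) : fps int :=
  if n is n'.+1 then
    (1 + 'q ^+ (2 * n)) * jacobi_coef n' k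
    - 'q ^+ n * ((if k is k'.+1 then jacobi_coef n' k' else - jacobi_coef n' 0)
                 + jacobi_coef n' k.+1)
  else (k == 0)%:R.

Lemma jacobi_coefS n k : jacobi_coef n.+1 k =
  (1 + 'q ^+ (2 * n.+1)) * jacobi_coef n k
  - 'q ^+ n.+1 * ((if k is k'.+1 then jacobi_coef n k' else - jacobi_coef n 0)
                  + jacobi_coef n k.+1).
Proof. by []. Qed.

Lemma jacobi_coef_eq0 n k : (n < k)%N -> jacobi_coef n k = 0.
Proof.
elim: n k => [|n IHn] [|k] // nk.
by rewrite jacobi_coefS !IHn ?mulr0 ?addr0 ?mulr0 ?subr0 // ltnW // ltnW.
Qed.

(** Up to sign, both sides are the derivative at z = 1 of the Laurent polynomial with these
    coefficients; antisymmetry folds k and -1-k into the weight 2k+1. The proof is by the recursion,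
    each step contributing 1 + q^(2n+2) - 2 q^(n+1) = (1 - q^(n+1))^2. *)
Lemma sum_jacobi_coef n N : (n <= N)%N ->
  \sum_(k < N.+1) (2 * k + 1)%:R * jacobi_coef n k = pochq n ^+ 2.
Proof.
elim: n N => [|n IHn] N nN.
  rewrite big_ord_recl big1 /= => [|i _]; last by rewrite mulr0.
  by rewrite pochq0 muln0 addr0 mul1r expr1n.
pose b := jacobi_coef n.
(* Summation by parts: adding the two neighbours doubles the weighted sum up to boundary terms,
   which vanish at M = N since N > n. *)
have parts M : \sum_(k < M.+1) (2 * k + 1)%:R *
      ((if k : nat is k'.+1 then b k' else - b 0) + b k.+1) =
    2 * (\sum_(k < M.+1) (2 * k + 1)%:R * b k)
    + (2 * M + 1)%:R * b M.+1 - (2 * M + 3)%:R * b M.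
  elim: M => [|M IHM]; first by rewrite !big_ord1 /=; ring.
  rewrite big_ord_recr /= IHM [in RHS]big_ord_recr /=.
  move: (\sum_(_ < _) _) => S; rewrite -[M.+1]addn1 !mulnDr !natrD !natrM.
  by move: (b M) (b (M + 1)) (b _.+1) => x y z; ring.
have bN : b N = 0 by apply: jacobi_coef_eq0.
have bN1 : b N.+1 = 0 by apply: jacobi_coef_eq0; apply: ltnW.
have := parts N; rewrite bN bN1 !mulr0 subr0 addr0 {1 2 3}/b IHn; last exact: ltnW.
move=> {}parts; rewrite pochqS.
rewrite (eq_bigr (fun k : 'I_N.+1 => (1 + 'q ^+ (2 * n.+1)) * ((2 * k + 1)%:R * b k) -
  'q ^+ n.+1 * ((2 * k + 1)%:R * ((if k : nat is k'.+1 then b k' else - b 0) + b k.+1)))).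
  rewrite sumrB -!mulr_sumr parts /b IHn 1?ltnW // mulnC exprM.
  by move: ('q ^+ n.+1) => x; ring.
by case=> [[|k] kN] _ /=; rewrite -/b; move: (_%:R) => c; ring.
Qed.

(** The closed form with the q-binomial coefficient, denominators cleared so that the recursion can
    verify it. *)
Lemma jacobi_coefE n k : (k <= n)%N ->
  jacobi_coef n k * (pochq (n - k) * pochq (n + k).+1) =
  (-1) ^+ k * 'q ^+ 'C(k.+1, 2) * pochq (2 * n).+1.
Proof.
elim: n k => [|n IHn] k kn.
  by move: kn; rewrite leqn0 => /eqP->; rewrite /= bin_small // muln0 addn0 pochq0; ring.
(* [b1], [b2] and [b3] bring the three terms of the recursion to the denominator of level n+1. At
   upper indices out of reach of the induction hypothesis, both sides vanish through a factor 1 -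
   q^0. In [b3] the factor q^k raises k(k-1)/2 to k(k+1)/2. *)
have b1 : jacobi_coef n k * (pochq (n.+1 - k) * pochq (n.+1 + k).+1) =
   (-1) ^+ k * 'q ^+ 'C(k.+1, 2) * pochq (2 * n).+1
     * (1 - 'q ^+ (n.+1 - k)) * (1 - 'q ^+ (n + k).+2).
  move: kn; rewrite leq_eqVlt => /orP[/eqP->|].
    by rewrite jacobi_coef_eq0 // subnn expr0 subrr !(mulr0, mul0r).
  rewrite ltnS => kn; rewrite subSn // addSn (pochqS (n - k)) (pochqS (n + k).+1) -(IHn k kn).
  by move: (pochq (n - k)) (pochq (n + k).+1) => x y; ring.
have b2 : jacobi_coef n k.+1 * (pochq (n.+1 - k) * pochq (n.+1 + k).+1) =
   - (-1) ^+ k * 'q ^+ 'C(k.+1, 2) * 'q ^+ k.+1 * pochq (2 * n).+1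
     * (1 - 'q ^+ (n.+1 - k)) * (1 - 'q ^+ (n - k)).
  case: (ltnP k n) => [lkn|].
    have -> : (n.+1 - k = (n - k.+1).+2)%N by lia.
    have -> : (n - k = (n - k.+1).+1)%N by lia.
    have := IHn _ lkn; rewrite (pochqS (n - k.+1).+1) (pochqS (n - k.+1)) addSnnS.
    rewrite (exprS _ k) (bin2S k.+1) (exprD _ 'C(k.+1, 2)).
    move: (pochq (n - k.+1)) (pochq (n + k.+1).+1) => x y H.
    rewrite [LHS](_ : _ = (1 - 'q ^+ (n - k.+1).+2) * (1 - 'q ^+ (n - k.+1).+1)
       * (jacobi_coef n k.+1 * (x * y))); first by rewrite H; ring.
    by ring.
  rewrite leq_eqVlt => /orP[/eqP<-|nk].
    by rewrite jacobi_coef_eq0 // subnn expr0 subrr !(mulr0, mul0r).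
  have -> : (n.+1 - k = 0)%N by lia.
  by rewrite jacobi_coef_eq0 1?ltnW // expr0 subrr !(mulr0, mul0r).
have b3 : 'q ^+ k * (if k is k'.+1 then jacobi_coef n k' else - jacobi_coef n 0)
    * (pochq (n.+1 - k) * pochq (n.+1 + k).+1) =
   - (-1) ^+ k * 'q ^+ 'C(k.+1, 2) * pochq (2 * n).+1
     * (1 - 'q ^+ (n + k).+1) * (1 - 'q ^+ (n + k).+2).
  case: k kn {b1 b2} => [|k] kn.
    have := IHn 0 (leq0n _); rewrite !subn0 !addn0 (pochqS n.+1) (pochqS n).
    move: (pochq n) => x H.
    rewrite [LHS](_ : _ = - (1 - 'q ^+ n.+1) * (1 - 'q ^+ n.+2)
      * (jacobi_coef n 0 * (x * (x * (1 - 'q ^+ n.+1))))).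
      by rewrite H; ring.
    by rewrite expr0; ring.
  have := IHn k kn; rewrite !addnS !addSn subSS (bin2S k.+1).
  rewrite (pochqS (n + k).+2) (pochqS (n + k).+1) => H.
  move: H; rewrite (exprD _ 'C(k.+1, 2)) (exprS (-1) k); move: (pochq (n - k)) (pochq (n + k).+1) => x y H.
  rewrite [LHS](_ : _ = 'q ^+ k.+1 * (1 - 'q ^+ (n + k).+2) * (1 - 'q ^+ (n + k).+3)
    * (jacobi_coef n k * (x * y))); first by rewrite H; ring.
  by ring.
rewrite jacobi_coefS.
(* At k = n+1 the subtraction [n - k] truncates and q * q^(n-k) is no longer q^(n+1-k); the identity
   survives because 1 - q^(n+1-k) is then 0. *)
have qX : 'q * (1 - 'q ^+ (n.+1 - k)) * (1 - 'q ^+ (n - k)) =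
    (1 - 'q ^+ (n.+1 - k)) * ('q - 'q ^+ (n.+1 - k)) :> fps int.
  move: kn; rewrite leq_eqVlt => /orP[/eqP->|].
    by rewrite subnn expr0 subrr !(mulr0, mul0r).
  by rewrite ltnS => kn; rewrite subSn // exprS; ring.
have q1 : 'q ^+ n.+1 = 'q ^+ (n.+1 - k) * 'q ^+ k :> fps int.
  by rewrite -exprD subnK.
have q2 : 'q ^+ (2 * n.+1) = 'q ^+ (n.+1 - k) * 'q ^+ (n + k).+1 :> fps int.
  by rewrite -exprD; congr (_ ^+ _); lia.
have -> : (2 * n.+1 = (2 * n).+2)%N by lia.
rewrite (pochqS (2 * n).+2) (pochqS (2 * n).+1) (exprS _ (2 * n).+2).
have -> : (2 * n).+2 = (2 * n.+1)%N by lia.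
move: b1 b2 b3; rewrite q2 (exprS _ (n + k).+1).
set c := _ * _ * pochq (2 * n).+1; set M := pochq _ * pochq _.
set bm := (if k is k'.+1 then _ else _).
set X := 'q ^+ (n.+1 - k) in qX q1 *; set Y := 'q ^+ (n + k).+1.
move=> b1 b2 b3.
rewrite [LHS](_ : _ = (1 + X * Y) * (jacobi_coef n k * M) - X * ('q ^+ k * bm * M)
   - 'q ^+ n.+1 * (jacobi_coef n k.+1 * M)); last by rewrite q1; ring.
rewrite b1 b3 b2.
have qY : 'q ^+ n.+1 * 'q ^+ k.+1 = 'q * Y.
  by rewrite -exprD -exprS; congr (_ ^+ _); lia.
have -> : (-1) ^+ k * 'q ^+ 'C(k.+1, 2) * (pochq (2 * n).+1 * (1 - X * Y) * (1 - 'q * (X * Y))) =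
  c * ((1 - X * Y) * (1 - 'q * (X * Y))) by rewrite /c; ring.
rewrite [LHS](_ : _ = c * ((1 + X * Y) * (1 - X) * (1 - 'q * Y) + X * (1 - Y) * (1 - 'q * Y)
    + ('q ^+ n.+1 * 'q ^+ k.+1) * ((1 - X) * (1 - 'q ^+ (n - k))))); last by rewrite /c; ring.
rewrite qY.
have -> : 'q * Y * ((1 - X) * (1 - 'q ^+ (n - k))) = Y * ((1 - X) * ('q - X)).
  by rewrite -qX; ring.
by ring.
Qed.

Lemma bin2_mod5_neq2 k : ('C(k.+1, 2) %% 5 != 2)%N.
Proof.
have kE : k = (5 * (k %/ 5) + k %% 5)%N by rewrite mulnC -divn_eq.
move: (ltn_pmod k (isT : 0 < 5)%N).
move: (k %/ 5)%N (k %% 5)%N kE => d t -> t5; rewrite -addnS bin2_mul5D.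
by move: 'C(d, 2) => b; case: t t5 => [|[|[|[|[|]]]]] // _; rewrite !bin2 /=; lia.
Qed.

(* By Jacobi, E^3 is the series of (-1)^k (2k+1) q^(k(k+1)/2). *)
Lemma sect2_E1_cube : sect 2 (E 1 ^+ 3) = 0.
Proof.
apply: fpsP => n; rewrite coefs0; set M := (5 * n + 2)%N.
rewrite -[LHS]/(coefs (E 1 ^+ 3) M).
have PE N : (M <= N)%N -> fps_eqm M.+1 (pochq N) (E 1).
  by move=> MN; apply: fps_eqmW (@pochq_eqmE N).
(* Two factors become finite products, to which [sum_jacobi_coef] applies; the third clears the
   denominator of the limiting coefficients. *)
have PEX : fps_eqm M.+1 (E 1 * pochq (2 * M) ^+ 2) (E 1 ^+ 3).
  rewrite (exprS (E 1)); apply: fps_eqmM => //; rewrite !expr2.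
  by apply: fps_eqmM; apply: PE; lia.
rewrite -PEX // -(@sum_jacobi_coef _ (2 * M)) // mulr_sumr.
rewrite (big_morph (fun f : fps int => coefs f M) (id1 := 0) (op1 := +%R)) //.
apply: big1 => k _; rewrite mulrCA.
have E1U : E 1 \is a GRing.unit by apply: E_unit.
(* At level 2M and for k <= M, all Pochhammer indices in [jacobi_coefE] are at least M, so each
   product is E_1 modulo q^(M+1). For k > M both sides vanish there, as k(k+1)/2 > M. *)
have EJ : fps_eqm M.+1 (E 1 * jacobi_coef (2 * M) k) ((-1) ^+ k * 'q ^+ 'C(k.+1, 2)).
  have kN : (k <= 2 * M)%N by rewrite -ltnS.
  case: (leqP k M) => kM.
    rewrite -[E 1 * _](mulrK E1U) -[X in fps_eqm _ _ X](mulrK E1U).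
    apply: fps_eqmM => //.
    have H1 : fps_eqm M.+1 (jacobi_coef (2 * M) k * (pochq (2 * M - k) * pochq (2 * M + k).+1))
        (E 1 * jacobi_coef (2 * M) k * E 1).
      rewrite [X in fps_eqm _ _ X](_ : _ = jacobi_coef (2 * M) k * (E 1 * E 1)); last by ring.
      by apply: fps_eqmM => //; apply: fps_eqmM; apply: PE; lia.
    apply: fps_eqm_trans (fps_eqm_sym H1) _; rewrite jacobi_coefE //.
    by apply: fps_eqmM => //; apply: PE; lia.
  have Mt : (M.+1 <= 'C(k.+1, 2))%N by rewrite bin2S; lia.
  apply: (@fps_eqm_trans _ _ _ 0); last first.
    by apply: fps_eqm_sym; rewrite mulrC; apply: fps_eqm_Xn.
  have PU : pochq (2 * M - k) * pochq (2 * M + k).+1 \is a GRing.unit.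
    by rewrite unitrM !pochq_unit.
  rewrite -[jacobi_coef _ _](mulrK PU) jacobi_coefE //.
  rewrite [(-1) ^+ k * _]mulrC -!mulrA mulrCA.
  by apply: fps_eqm_Xn.
have {EJ} := fps_eqmM (@fps_eqm_refl _ _ (2 * k + 1)%:R) EJ; move=> -> //.
have : coefs ('q ^+ 'C(k.+1, 2) : fps int) M = 0.
  rewrite coefsXn; case: eqP => // ME; have := bin2_mod5_neq2 k.
  by rewrite -ME /M mulnC modnMDl.
rewrite mulr_natl; elim: (2 * k + 1)%N => [|c IHc] C0; first by rewrite mulr0n coefs0.
rewrite mulrS coefsD IHc // addr0 -signr_odd.
by case: odd; rewrite ?expr1 ?expr0 ?mulN1r ?mul1r ?coefsN C0 ?oppr0.
Qed.

(** * The modular equation of degree 5 *)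

(** The part of (A - C - B)^3 with exponents 2 modulo 5 is 3 A (C^2 - A B). It is zero by Jacobi's
    identity, 3 is cancellable over the integers, and A has invertible constant term. *)
Lemma E1_dissection_rel : sect 0 (E 1) * - sect 2 (E 1) = E 5 ^+ 2.
Proof.
set a : fps int := sect 0 (E 1); set b : fps int := - sect 2 (E 1).
have EE : E 1 = subst5 a - 'q * subst5 (E 5) - 'q ^+ 2 * subst5 b.
  by rewrite [LHS]E1_dissection rmorphN /= mulrN opprK.
have sectD r f g : sect r (f + g : fps int) = sect r f + sect r g by exact: raddfD.
have : sect 2 (E 1 ^+ 3) = 3 * (a * (E 5 ^+ 2 - a * b)).
  rewrite [in LHS]EE; set c := E 5.
  rewrite (_ : _ ^+ 3 = subst5 (a ^+ 3) * 'q ^+ 0 + subst5 (- (3 * a ^+ 2 * c)) * 'q ^+ 1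
    + subst5 (3 * a * c ^+ 2 - 3 * a ^+ 2 * b) * 'q ^+ 2
    + subst5 (6 * a * b * c - c ^+ 3) * 'q ^+ 3
    + subst5 (3 * a * b ^+ 2 - 3 * c ^+ 2 * b) * 'q ^+ 4
    + subst5 (- (3 * c * b ^+ 2)) * 'q ^+ 5 + subst5 (- b ^+ 3) * 'q ^+ 6).
    rewrite !sectD !sectVM // !sectXn //= expr0 !mulr0 !addr0 !add0r mulr1.
    have R3 (x y z : fps int) : 3 * x * z ^+ 2 - 3 * x ^+ 2 * y = 3 * (x * (z ^+ 2 - x * y)) by ring.
    exact: R3.
  clearbody a b c; rewrite !(rmorphD, rmorphN, rmorphB) /= !(rmorphM, rmorph_nat, rmorphXn) /=.
  by ring.
rewrite sect2_E1_cube => /esym/eqP; rewrite mulr_natl => H.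
have {H} : a * (E 5 ^+ 2 - a * b) = 0.
  move/eqP: H; move: (a * _) => x; rewrite !mulrS mulr0n addr0 => H.
  apply: fpsP => n; have := congr1 (fun f : fps int => coefs f n) H.
  by rewrite !coefsD coefs0; lia.
have aU : a \is a GRing.unit.
  by have := @E_unit 1 isT; rewrite !fps_unitE /= muln0.
move/(congr1 ( *%R a^-1)); rewrite mulKr // mulr0 => /eqP.
by rewrite subr_eq0 => /eqP.
Qed.

Section QuinticNorm.
Variables (R : comNzRingType) (w : R).
Hypothesis w_sum : 1 + w + w ^+ 2 + w ^+ 3 + w ^+ 4 = 0.

Lemma root5_expr5 : w ^+ 5 = 1.
Proof.
apply/eqP; rewrite -subr_eq0; apply/eqP.
by rewrite -[RHS](mul0r (w - 1)) -w_sum; ring.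
Qed.

(** Pairing the factors of w^k and w^-k leaves only the periods s = w + w^4 and t = w^2 + w^3, whose
    sum and product are both -1. *)
Lemma quintic_norm (A B C : R) :
  (A - C - B) * (A - w * C - w ^+ 2 * B) * (A - w ^+ 2 * C - w ^+ 4 * B)
   * (A - w ^+ 3 * C - w ^+ 6 * B) * (A - w ^+ 4 * C - w ^+ 8 * B)
  = A ^+ 5 - C ^+ 5 - B ^+ 5 - 5 * (A * B) * C ^+ 3 - 5 * (A * B) ^+ 2 * C.
Proof.
have w5 := root5_expr5.
have w6 : w ^+ 6 = w by rewrite [LHS](exprD w 5 1) w5 mul1r.
have w7 : w ^+ 7 = w ^+ 2 by rewrite [LHS](exprD w 5 2) w5 mul1r.
have w8 : w ^+ 8 = w ^+ 3 by rewrite [LHS](exprD w 5 3) w5 mul1r.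
pose s := w + w ^+ 4; pose t := w ^+ 2 + w ^+ 3.
have st1 : s + t = -1.
  by apply/eqP; rewrite -subr_eq0 opprK -w_sum /s /t; apply/eqP; ring.
have st2 : s * t = -1.
  by rewrite -st1 /s /t (_ : _ * _ = w ^+ 3 + w ^+ 4 + w ^+ 6 + w ^+ 7); [rewrite w6 w7|]; ring.
have s2t2 : s ^+ 2 + t ^+ 2 = 3.
  by rewrite (_ : _ + _ = (s + t) ^+ 2 - 2 * (s * t)); [rewrite st1 st2|]; ring.
pose U := A ^+ 2 + C ^+ 2 + B ^+ 2; pose X := A * C - C * B; pose Y := A * B.
have P14 : (A - w * C - w ^+ 2 * B) * (A - w ^+ 4 * C - w ^+ 8 * B) = U - s * X - t * Y.
  rewrite w8 [LHS](_ : _ = A ^+ 2 + w ^+ 5 * (C ^+ 2 + B ^+ 2) - s * (A * C) - t * Y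
     + (w ^+ 4 + w ^+ 6) * (C * B)); last by rewrite /s /t /Y; ring.
  by rewrite w5 w6 /U /s /X; ring.
have P23 : (A - w ^+ 2 * C - w ^+ 4 * B) * (A - w ^+ 3 * C - w ^+ 6 * B) = U - t * X - s * Y.
  rewrite w6 [LHS](_ : _ = A ^+ 2 + w ^+ 5 * (C ^+ 2 + B ^+ 2) - t * (A * C) - s * Y
     + (w ^+ 3 + w ^+ 7) * (C * B)); last by rewrite /s /t /Y; ring.
  by rewrite w5 w7 /U /t /X; ring.
rewrite [LHS](_ : _ = (A - C - B) * (((A - w * C - w ^+ 2 * B) * (A - w ^+ 4 * C - w ^+ 8 * B)) *
  ((A - w ^+ 2 * C - w ^+ 4 * B) * (A - w ^+ 3 * C - w ^+ 6 * B)))); last first.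
  by move: (A - C - B) (A - w * C - _) (A - w ^+ 2 * C - _) (A - w ^+ 3 * C - _)
    (A - w ^+ 4 * C - _) => *; ring.
rewrite P14 P23.
rewrite [_ * (U - t * X - s * Y)](_ : _ = U ^+ 2 - (s + t) * U * (X + Y)
  + s * t * (X ^+ 2 + Y ^+ 2) + (s ^+ 2 + t ^+ 2) * X * Y); last by ring.
rewrite st1 st2 s2t2.
by rewrite /U /X /Y; ring.
Qed.

Lemma quintic_norm_sub (x : R) :
  (1 - x) * (1 - w * x) * (1 - w ^+ 2 * x) * (1 - w ^+ 3 * x) * (1 - w ^+ 4 * x)
  = 1 - x ^+ 5.
Proof. by have := quintic_norm 1 0 x; rewrite !(mulr0, subr0) => ->; ring. Qed.

Lemma root5_sum_exp i : (0 < i < 5)%N ->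
  1 + w ^+ i + (w ^+ i) ^+ 2 + (w ^+ i) ^+ 3 + (w ^+ i) ^+ 4 = 0.
Proof.
have w5 := root5_expr5.
case: i => [|[|[|[|[|]]]]] // _; rewrite -[RHS]w_sum -?exprM.
- rewrite [w ^+ (2 * 3)](exprD w 5 1) [w ^+ (2 * 4)](exprD w 5 3) w5; ring.
- rewrite [w ^+ (3 * 2)](exprD w 5 1) [w ^+ (3 * 3)](exprD w 5 4) [w ^+ (3 * 4)](exprD w 5 7).
  rewrite [w ^+ 7](exprD w 5 2) w5; ring.
- rewrite [w ^+ (4 * 2)](exprD w 5 3) [w ^+ (4 * 3)](exprD w 5 7) [w ^+ (4 * 4)](exprD w 5 11).
  by rewrite [w ^+ 7](exprD w 5 2) [w ^+ 11](exprD w 5 6) [w ^+ 6](exprD w 5 1) w5; ring.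
Qed.

End QuinticNorm.

Section Twist.
Variables (R : comNzRingType) (w : R).
Hypothesis w_sum : 1 + w + w ^+ 2 + w ^+ 3 + w ^+ 4 = 0.

Definition fps_cst (x : R) : fps R := Fps (fun n => if n == 0 then x else 0).

Lemma coefs_cstM x f n : coefs (fps_cst x * f) n = x * coefs f n.
Proof. by rewrite coefsM big_ord_recl /= subn0 big1 ?addr0 // => i _; rewrite mul0r. Qed.

Lemma coefs_cstXM x k f n : coefs (fps_cst x ^+ k * f) n = x ^+ k * coefs f n.
Proof.
by elim: k => [|k IHk]; rewrite ?expr0 ?mul1r // !exprS -!mulrA coefs_cstM IHk.
Qed.

Lemma fps_cst_root5_sum : 1 + fps_cst w + fps_cst w ^+ 2 + fps_cst w ^+ 3 + fps_cst w ^+ 4 = 0.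
Proof.
apply: fpsP => n; rewrite -[X in coefs X _]mulr1 !mulrDl mul1r !coefsD !coefs_cstXM coefs_cstM.
rewrite coefs0; move: (coefs 1 n) => c.
by rewrite -[RHS](mul0r c) -w_sum; ring.
Qed.

(** The conjugate f(w^k q), with coefficients mapped to R; [twist 0] is mere extension of
    scalars. *)
Definition twist (k : nat) (f : fps int) : fps R :=
  Fps (fun n => (coefs f n)%:~R * w ^+ (k * n)).

Fact twist_is_additive k : additive (twist k).
Proof. by move=> f g; apply: fpsP => n /=; rewrite rmorphB mulrBl. Qed.
HB.instance Definition _ k := GRing.isZmodMorphism.Build _ _ (twist k) (twist_is_additive k).

Fact twist_is_monoid_morphism k : monoid_morphism (twist k).
Proof.
split=> [|f g]; apply: fpsP => n.
  by case: n => [|n] /=; rewrite ?muln0 ?mulr1 ?mul0r.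
rewrite [LHS]/= coefsM rmorph_sum mulr_suml; apply: eq_bigr => i _.
rewrite rmorphM /= mulrACA -exprD -mulnDr subnKC //.
by rewrite -ltnS.
Qed.
HB.instance Definition _ k := GRing.isMonoidMorphism.Build _ _ (twist k) (twist_is_monoid_morphism k).

Lemma twistX k : twist k 'q = fps_cst w ^+ k * 'q.
Proof.
apply: fpsP => n; rewrite coefs_cstXM /=.
by case: eqP => [->|_]; rewrite ?muln1 ?mulr1 ?mul1r // mul0r mulr0.
Qed.

Lemma twist_subst5 k f : twist k (subst5 f) = twist 0 (subst5 f).
Proof.
apply: fpsP => n /=; case: ifP => [/dvdnP[d ->]|]; last by rewrite !mul0r.
by rewrite mul0n [in w ^+ _](mulnC d) (mulnCA k) exprM root5_expr5 // expr1n.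
Qed.

Lemma twist_cvg k u f : fps_cvg u f -> fps_cvg (twist k \o u) (twist k f).
Proof. by move=> uf n; have [N HN] := uf n; exists N => M /HN /= ->. Qed.

Definition twist_norm (f : fps int) : fps R :=
  twist 0 f * twist 1 f * twist 2 f * twist 3 f * twist 4 f.

Lemma twist_normM f g : twist_norm (f * g) = twist_norm f * twist_norm g.
Proof. by rewrite /twist_norm !rmorphM /=; ring. Qed.

Lemma twist_norm_subst5 f : twist_norm (subst5 f) = twist 0 (subst5 f) ^+ 5.
Proof.
rewrite /twist_norm !(twist_subst5 1, twist_subst5 2, twist_subst5 3, twist_subst5 4).
ring.
Qed.

(** The exponent is prime to 5, so the conjugation multiplies the power of q by each fifth root of
    unity once. *)
Lemma twist_norm_subXn n i : (0 < i < 5)%N ->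
  twist_norm (1 - 'q ^+ (5 * n + i)) = twist 0 (subst5 (1 - 'q ^+ (5 * n + i))).
Proof.
move=> i5; pose W := fps_cst w.
have W_sum := fps_cst_root5_sum; have W5 := root5_expr5 W_sum.
have tE k : twist k (1 - 'q ^+ (5 * n + i)) = 1 - (W ^+ i) ^+ k * twist 0 'q ^+ (5 * n + i).
  rewrite rmorphB rmorph1 rmorphXn /= !twistX expr0 mul1r exprMn -!exprM mulnDr exprD.
  by rewrite mulnCA exprM W5 expr1n mul1r mulnC.
rewrite /twist_norm !tE expr0 mul1r expr1 quintic_norm_sub; last exact: root5_sum_exp.
by rewrite rmorphB rmorph1 rmorphXn /= subst5X rmorphB rmorph1 !rmorphXn -!exprM mulnC.
Qed.

(** A factor 1 - q^i has norm 1 - q^(5i) if 5 does not divide i, and (1 - q^i)^5 otherwise. The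
    second product on the left supplies the multiples of 25 missing from the first kind. *)
Lemma twist_norm_pochq N :
  twist_norm (pochq (5 * N)) * twist 0 (subst5 (subst5 (pochq N))) =
  twist 0 (subst5 (pochq (5 * N))) * twist 0 (subst5 (pochq N)) ^+ 5.
Proof.
elim: N => [|N IHN]; first by rewrite muln0 pochq0 /twist_norm !rmorph1; ring.
have -> : (5 * N.+1 = (5 * N).+4.+1)%N by lia.
rewrite (pochqS (5 * N).+4) (pochqS (5 * N).+3) (pochqS (5 * N).+2) (pochqS (5 * N).+1).
rewrite (pochqS (5 * N)) (pochqS N) !twist_normM.
have E5 : 1 - 'q ^+ (5 * N).+4.+1 = subst5 (1 - 'q ^+ N.+1) :> fps int.
  by rewrite rmorphB rmorph1 rmorphXn /= subst5X -exprM; congr (_ - _ ^+ _); lia.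
rewrite E5 twist_norm_subst5 -{1}[(5 * N).+1]addn1 -{1}[(5 * N).+2]addn2.
rewrite -{1}[(5 * N).+3]addn3 -{1}[(5 * N).+4]addn4 !twist_norm_subXn //.
rewrite addn1 addn2 addn3 addn4.
have sM (f g : fps int) : subst5 (f * g) = subst5 f * subst5 g by exact: rmorphM.
have tM f g : twist 0 (f * g) = twist 0 f * twist 0 g by exact: rmorphM.
rewrite !sM !tM.
have R9 (n x y z e1 e2 e3 e4 e5 g : fps R) : n * x = y * z ^+ 5 ->
    n * e1 * e2 * e3 * e4 * g ^+ 5 * (x * e5) = y * e1 * e2 * e3 * e4 * e5 * (z * g) ^+ 5.
  move=> H; rewrite exprMn [LHS](_ : _ = n * x * (e1 * e2 * e3 * e4 * g ^+ 5 * e5)); last by ring.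
  by rewrite H; ring.
exact: R9.
Qed.

Lemma twist_norm_E1 : twist_norm (E 1) * twist 0 (E 25) = twist 0 (E 5) ^+ 6.
Proof.
have le5 n : (n <= 5 * n)%N by lia.
have c5 := fps_cvg_sub le5 pochq_cvg.
have cE5 : fps_cvg (fun N => twist 0 (subst5 (pochq (5 * N)))) (twist 0 (E 5)).
  by rewrite -(@subst5E 1) //; exact: (twist_cvg 0 (subst5_cvg c5)).
have cE5' : fps_cvg (fun N => twist 0 (subst5 (pochq N))) (twist 0 (E 5)).
  by rewrite -(@subst5E 1) //; exact: (twist_cvg 0 (subst5_cvg pochq_cvg)).
have cE25 : fps_cvg (fun N => twist 0 (subst5 (subst5 (pochq N)))) (twist 0 (E 25)).
  rewrite -(@subst5E 5) // -(@subst5E 1) //.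
  exact: (twist_cvg 0 (subst5_cvg (subst5_cvg pochq_cvg))).
rewrite exprS; apply: fps_cvg_unique (fps_cvgM cE5 (fps_cvgX 5 cE5')).
apply: eq_fps_cvg twist_norm_pochq _.
apply: fps_cvgM cE25; have t k := twist_cvg k c5.
exact: fps_cvgM (fps_cvgM (fps_cvgM (fps_cvgM (t 0) (t 1)) (t 2)) (t 3)) (t 4).
Qed.

End Twist.

(** The integers embed in [algC], so identities obtained with this w descend to [fps int]. *)
Lemma exists_root5 : exists w : algC, 1 + w + w ^+ 2 + w ^+ 3 + w ^+ 4 = 0.
Proof.
have [w w5] := C_prim_root_exists (isT : 0 < 5)%N; exists w.
have w1 : w - 1 != 0.
  by rewrite subr_eq0 -(expr0 w) -{1}(expr1 w) (eq_prim_root_expr w5).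
apply: (mulfI w1); rewrite mulr0 [LHS](_ : _ = w ^+ 5 - 1); last by ring.
by rewrite (prim_expr_order w5) subrr.
Qed.

(* Ramanujan: with C = q E_25 and T = E_5^6 / (q^5 E_25^6), the series
   z = E_1 / C satisfies z^5 + 5 z^4 + 15 z^3 + 25 z^2 + 25 z = T. *)
Lemma modular_equation (C := 'q * E 25) :
  (E 1 ^+ 5 + 5 * C * E 1 ^+ 4 + 15 * C ^+ 2 * E 1 ^+ 3 + 25 * C ^+ 3 * E 1 ^+ 2
     + 25 * C ^+ 4 * E 1) * E 25 = E 5 ^+ 6.
Proof.
set a : fps int := sect 0 (E 1); set b : fps int := - sect 2 (E 1).
have VE5 : subst5 (E 5) = E 25 by rewrite subst5E.
pose A := subst5 a; pose B := 'q ^+ 2 * subst5 b.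
have EE : E 1 = A - C - B.
  by rewrite /A /B /C [LHS]E1_dissection -VE5 rmorphN /= mulrN opprK.
have ABC : A * B = C ^+ 2.
  rewrite /A /B /C mulrCA -rmorphM /= E1_dissection_rel rmorphXn /= VE5; ring.
(* As A - B = E_1 + C and A B = C^2, the difference A^5 - B^5 is a polynomial in E_1 and C. *)
rewrite [X in X * _](_ : _ = A ^+ 5 - 11 * C ^+ 5 - B ^+ 5); last first.
  rewrite EE [LHS](_ : _ = (A - B) ^+ 5 + 5 * C ^+ 2 * (A - B) ^+ 3
    + 5 * (C ^+ 2) ^+ 2 * (A - B) - 11 * C ^+ 5); last by ring.
  by rewrite -ABC; ring.
have [w w_sum] := exists_root5.
suff H : twist w 0 ((A ^+ 5 - 11 * C ^+ 5 - B ^+ 5) * E 25) = twist w 0 (E 5 ^+ 6).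
  apply: fpsP => n; have := congr1 (fun f => coefs f n) H.
  by rewrite /= mul0n expr0 !mulr1 => /eqP; rewrite eqr_int => /eqP.
rewrite rmorphM rmorphXn /= -(twist_norm_E1 w_sum); congr (_ * _).
pose W := fps_cst w.
have tB k f g : twist w k (f - g) = twist w k f - twist w k g by exact: rmorphB.
have tM k f g : twist w k (f * g) = twist w k f * twist w k g by exact: rmorphM.
have tE k : twist w k (E 1) = twist w 0 A - W ^+ k * twist w 0 C - W ^+ (2 * k) * twist w 0 B.
  rewrite EE /A /B /C -VE5 expr2 !tB !tM !(twist_subst5 w_sum k) !twistX mulnC exprM.
  by rewrite expr0; move: (fps_cst w ^+ k) => x; ring.
have H := quintic_norm (fps_cst_root5_sum w_sum) (twist w 0 A) (twist w 0 B) (twist w 0 C).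
rewrite /twist_norm !(tE 1) !(tE 2) !(tE 3) !(tE 4) EE !tB expr1 H -(tM 0 A) ABC.
rewrite !tM rmorph_nat /=; move: (twist w 0 A) (twist w 0 B) (twist w 0 C) => x y z.
by ring.
Qed.

(** * Action of U on powers of x and of tau *)

(** Initial values for [sect0_xi_rec]. Expanding C^n E_1^(5-n) in A, B and C, U keeps only the
    monomials of q-shift 5, in which A and B occur equally often; A B = C^2 makes them multiples of
    C^5, and U(C^5) = q E_5^5. *)
Lemma sect0_E1_monomials :
  [/\ sect 0 (('q * E 25) ^+ 4 * E 1) = - ('q * E 5 ^+ 5),
      sect 0 (('q * E 25) ^+ 3 * E 1 ^+ 2) = - ('q * E 5 ^+ 5),
      sect 0 (('q * E 25) ^+ 2 * E 1 ^+ 3) = 5 * ('q * E 5 ^+ 5) &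
      sect 0 ('q * E 25 * E 1 ^+ 4) = - (5 * ('q * E 5 ^+ 5))].
Proof.
have ab := E1_dissection_rel.
have : E 1 = subst5 (sect 0 (E 1)) - 'q * subst5 (E 5) - 'q ^+ 2 * subst5 (- sect 2 (E 1)).
  by rewrite [LHS]E1_dissection rmorphN /= mulrN opprK.
have -> : E 25 = subst5 (E 5) by rewrite subst5E.
move: (E 1) (E 5) (sect 0 (E 1)) (- sect 2 (E 1)) ab => e c a b ab ->.
have sectD (f g : fps int) : sect 0 (f + g) = sect 0 f + sect 0 g by exact: raddfD.
have V p s : sect 0 (subst5 p * 'q ^+ s) = (if (s %% 5 == 0)%N then p * 'q ^+ (s %/ 5) else 0) :> fps int.
  by rewrite sectVM // sectXn //; case: ifP; rewrite ?mulr0.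
split.
- rewrite (_ : _ * _ = subst5 (a * c ^+ 4) * 'q ^+ 4 + subst5 (- c ^+ 5) * 'q ^+ 5
    + subst5 (- (c ^+ 4 * b)) * 'q ^+ 6).
    by rewrite !sectD !V /= expr1 add0r addr0; ring.
  by rewrite !(rmorphD, rmorphN, rmorphB) /= !(rmorphM, rmorph_nat, rmorphXn) /=; ring.
- rewrite (_ : _ * _ = subst5 (a ^+ 2 * c ^+ 3) * 'q ^+ 3 + subst5 (- (2 * a * c ^+ 4)) * 'q ^+ 4
    + subst5 (c ^+ 3 * (c ^+ 2 - 2 * (a * b))) * 'q ^+ 5 + subst5 (2 * b * c ^+ 4) * 'q ^+ 6
    + subst5 (b ^+ 2 * c ^+ 3) * 'q ^+ 7).
    by rewrite !sectD !V /= expr1 !add0r !addr0 ab; ring.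
  by rewrite !(rmorphD, rmorphN, rmorphB) /= !(rmorphM, rmorph_nat, rmorphXn) /=; ring.
- rewrite (_ : _ * _ = subst5 (c ^+ 2 * a ^+ 3) * 'q ^+ 2 + subst5 (- (3 * a ^+ 2 * c ^+ 3)) * 'q ^+ 3
    + subst5 (c ^+ 2 * (3 * a * c ^+ 2 - 3 * a ^+ 2 * b)) * 'q ^+ 4
    + subst5 (c ^+ 3 * (6 * (a * b) - c ^+ 2)) * 'q ^+ 5
    + subst5 (c ^+ 2 * (3 * a * b ^+ 2 - 3 * c ^+ 2 * b)) * 'q ^+ 6
    + subst5 (- (3 * c ^+ 3 * b ^+ 2)) * 'q ^+ 7 + subst5 (- (c ^+ 2 * b ^+ 3)) * 'q ^+ 8).
    by rewrite !sectD !V /= expr1 !add0r !addr0 ab; ring.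
  by rewrite !(rmorphD, rmorphN, rmorphB) /= !(rmorphM, rmorph_nat, rmorphXn) /=; ring.
- rewrite (_ : _ * _ = subst5 (c * a ^+ 4) * 'q ^+ 1 + subst5 (- (4 * a ^+ 3 * c ^+ 2)) * 'q ^+ 2
    + subst5 (c * (6 * a ^+ 2 * c ^+ 2 - 4 * a ^+ 3 * b)) * 'q ^+ 3
    + subst5 (c * (12 * a ^+ 2 * b * c - 4 * a * c ^+ 3)) * 'q ^+ 4
    + subst5 (c * (c ^+ 4 - 12 * (a * b) * c ^+ 2 + 6 * (a * b) ^+ 2)) * 'q ^+ 5
    + subst5 (c * (4 * c ^+ 3 * b - 12 * a * c * b ^+ 2)) * 'q ^+ 6
    + subst5 (c * (6 * c ^+ 2 * b ^+ 2 - 4 * a * b ^+ 3)) * 'q ^+ 7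
    + subst5 (4 * c ^+ 2 * b ^+ 3) * 'q ^+ 8 + subst5 (c * b ^+ 4) * 'q ^+ 9).
    by rewrite !sectD !V /= expr1 !add0r !addr0 ab; ring.
  by rewrite !(rmorphD, rmorphN, rmorphB) /= !(rmorphM, rmorph_nat, rmorphXn) /=; ring.
Qed.

(* With z and T as in modular_equation, xi = 1 / z and tau(q^5) = 1 / T(q). *)
Definition tau : fps int := 'q * E 5 ^+ 6 / E 1 ^+ 6.

Definition xi : fps int := 'q * E 25 / E 1.

Lemma subst5_inv (f : fps int) : f \is a GRing.unit -> subst5 f^-1 = (subst5 f)^-1.
Proof. exact: rmorphV. Qed.

Lemma E1E5_unit : (E 1 \is a GRing.unit) * (E 5 \is a GRing.unit) * (E 25 \is a GRing.unit).
Proof. by split; [split|]; apply: E_unit. Qed.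

(** The source of the index 6i in the recursion for [a]: it turns tau^l U(tau^l) into U(xi^(6l)). *)
Lemma xi6 : subst5 tau * tau = xi ^+ 6.
Proof.
have [[U1 U5] U25] := E1E5_unit.
have -> : subst5 tau = 'q ^+ 5 * E 25 ^+ 6 / E 5 ^+ 6.
  rewrite /tau 2!rmorphM /= subst5_inv ?unitrX // !rmorphXn /= subst5X.
  by rewrite -(@subst5E 5) // -(@subst5E 1).
rewrite /tau /xi expr_div_n !exprMn.
rewrite [LHS](_ : _ = ('q ^+ 6 * E 25 ^+ 6 / E 1 ^+ 6) * (E 5 ^+ 6 / E 5 ^+ 6)).
  by rewrite divrr ?unitrX // mulr1.
move: (_ ^- 6) (E 1 ^- 6) => r s; ring.
Qed.

(** The modular equation reads y (1 + 5 xi + 15 xi^2 + 25 xi^3 + 25 xi^4) = 1 with y xi^5 =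
    tau(q^5). Multiplying by xi^i and applying U gives the recursion. The bounds on i are strict
    because the contribution U(1) = 1 and the initial values of U(y xi^n), n < 5, make up m(i,1). *)
Lemma sect0_xi_rec i : (0 < i)%N ->
  sect 0 (xi ^+ i) = tau * ((m i 1)%:~R
    + (if (1 < i)%N then 25 * sect 0 (xi ^+ (i - 1)) else 0)
    + (if (2 < i)%N then 25 * sect 0 (xi ^+ (i - 2)) else 0)
    + (if (3 < i)%N then 15 * sect 0 (xi ^+ (i - 3)) else 0)
    + (if (4 < i)%N then 5 * sect 0 (xi ^+ (i - 4)) else 0)
    + (if (5 < i)%N then sect 0 (xi ^+ (i - 5)) else 0)).
Proof.
have [[U1 U5] U25] := E1E5_unit.
have V1 : subst5 (E 1) = E 5 by rewrite subst5E.
have V5 : subst5 (E 5) = E 25 by rewrite subst5E.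
pose kap : fps int := E 5 / E 1 ^+ 6.
(* This is tau(q^5) / xi^5, written without dividing by the non-unit xi. *)
pose y := subst5 kap * E 1 ^+ 5.
have kE : subst5 kap * E 5 ^+ 6 = E 25.
  by rewrite /kap rmorphM /= subst5_inv ?unitrX // rmorphXn /= V1 V5 divrK // unitrX.
have xE : xi * E 1 = 'q * E 25 by rewrite /xi divrK.
have y1 : y * (1 + 5 * xi + 15 * xi ^+ 2 + 25 * xi ^+ 3 + 25 * xi ^+ 4) = 1.
  apply: (mulIr U25); rewrite mul1r -[RHS]kE -modular_equation -xE /y.
  by ring.
have sectD (f g : fps int) : sect 0 (f + g) = sect 0 f + sect 0 g by exact: raddfD.
have sectZ k (f : fps int) : sect 0 (k%:R * f) = k%:R * sect 0 f.
  by rewrite !mulr_natl raddfMn.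
have rec1 : sect 0 (xi ^+ i) = sect 0 (y * xi ^+ i) + 5 * sect 0 (y * xi ^+ i.+1)
    + 15 * sect 0 (y * xi ^+ i.+2) + 25 * sect 0 (y * xi ^+ i.+3) + 25 * sect 0 (y * xi ^+ i.+4).
  rewrite -!sectZ -!sectD; congr (sect 0 _); rewrite -[LHS]mulr1 -[X in _ * X = _]y1.
  by rewrite !(exprS xi); ring.
have yx5 n : sect 0 (y * xi ^+ (n + 5)) = tau * sect 0 (xi ^+ n).
  have -> : y * xi ^+ (n + 5) = subst5 (kap * ('q * E 5 ^+ 5)) * xi ^+ n.
    rewrite (rmorphM _ kap) (rmorphM _ 'q) (rmorphXn _ 5 (E 5)) /= subst5X V5.
    rewrite -exprMn -xE exprD /y; ring.
  by rewrite sectVM //; congr (_ * _); rewrite /tau /kap; move: (E 1 ^- 6) => r; ring.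
have yxn n k : (0 < n)%N -> (n + k = 5)%N ->
    sect 0 (y * xi ^+ n) = kap * sect 0 (('q * E 25) ^+ n * E 1 ^+ k).
  move=> n0 nk; rewrite -sectVM // /y -xE (exprMn n xi); congr (sect 0 _).
  have -> : E 1 ^+ 5 = E 1 ^+ n * E 1 ^+ k by rewrite -exprD nk.
  by ring.
have [s4 s3 s2 s1] := sect0_E1_monomials.
have kt : kap * ('q * E 5 ^+ 5) = tau.
  by rewrite /kap /tau; move: (E 1 ^- 6) => r; ring.
pose u n := sect 0 (y * xi ^+ n); pose g n := sect 0 (xi ^+ n).
have u1 : u 1 = - 5 * tau by rewrite /u (yxn 1 4) // expr1 s1 -kt; ring.
have u2 : u 2 = 5 * tau by rewrite /u (yxn 2 3) // s2 -kt; ring.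
have u3 : u 3 = - tau by rewrite /u (yxn 3 2) // s3 -kt; ring.
have u4 : u 4 = - tau by rewrite /u (yxn 4 1) // s4 -kt; ring.
have u5 n : u (n + 5)%N = tau * g n by exact: yx5.
have g0 : g 0 = 1 by rewrite /g expr0 sect_one.
move=> i0; rewrite {}rec1 -!/(u _) -!/(g _).
clearbody u g.
case: i i0 => [//|[|[|[|[|[|i]]]]]] _; rewrite ?subSS ?subn0 /=.
- by rewrite u1 u2 u3 u4 (u5 0) g0; ring.
- by rewrite u2 u3 u4 (u5 0) (u5 1) g0; ring.
- by rewrite u3 u4 (u5 0) (u5 1) (u5 2) g0; ring.
- by rewrite u4 (u5 0) (u5 1) (u5 2) (u5 3) g0; ring.
- by rewrite (u5 0) (u5 1) (u5 2) (u5 3) (u5 4) g0; ring.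
have u5' n : u n.+4.+1 = tau * g n by rewrite -u5 addnC.
by rewrite nth_nil !u5'; ring.
Qed.

Lemma m_rec i j : m i.+1 j.+2 = 25 * m (i.+1 - 1) j.+1 + 25 * m (i.+1 - 2) j.+1
  + 15 * m (i.+1 - 3) j.+1 + 5 * m (i.+1 - 4) j.+1 + m (i.+1 - 5) j.+1.
Proof. by []. Qed.

#[local] Arguments m : simpl never.
#[local] Arguments a : simpl never.

Lemma sect0_xiX i N : (0 < i)%N -> (i <= N)%N ->
  sect 0 (xi ^+ i) = \sum_(1 <= j < N.+1) (m i j)%:~R * tau ^+ j.
Proof.
elim/ltn_ind: i N => i IHi [|N] i0 iN; first by case: i i0 iN {IHi}.
(* The guard at k = 0 matches [m 0 j] = 0; the true value U(1) = 1 is already counted in m(i,1). *)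
have IH k : (k < i)%N ->
    (if (0 < k)%N then sect 0 (xi ^+ k) else 0) = \sum_(1 <= j < N.+1) (m k j)%:~R * tau ^+ j.
  move=> ki; case: (ltnP 0 k) => k0; first by apply: IHi => //; lia.
  by move: k0; rewrite leqn0 => /eqP->; rewrite big1 // => -[|j] _; rewrite mul0r.
rewrite sect0_xi_rec // big_nat_recl // expr1.
have IHc c k : (if (k < i)%N then c * sect 0 (xi ^+ (i - k)) else 0) =
    c * (if (0 < i - k)%N then sect 0 (xi ^+ (i - k)) else 0).
  by rewrite subn_gt0; case: ifP; rewrite ?mulr0.
rewrite !IHc (_ : (if (5 < i)%N then _ else _) =
  if (0 < i - 5)%N then sect 0 (xi ^+ (i - 5)) else 0); last by rewrite subn_gt0.
rewrite !IH; try lia.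
rewrite -!addrA mulrDr mulrC; congr (_ + _).
rewrite !mulr_sumr -!big_split /= mulr_sumr; apply: eq_big_nat => j /andP[j0 _].
case: i i0 {IHi IH IHc iN} => // i _; case: j j0 => // j _.
rewrite m_rec !rmorphD !rmorphM /= (exprS _ j.+1).
move: (tau ^+ j.+1) => t.
by ring.
Qed.

(** Here tau is q times a unit, hence cancellable though not invertible. *)
Lemma tau_cancel l (f g : fps int) : tau ^+ l * f = tau ^+ l * g -> f = g.
Proof.
have [[U1 U5] U25] := E1E5_unit.
have UE : (E 5 ^+ 6 / E 1 ^+ 6) ^+ l \is a GRing.unit.
  by rewrite unitrX // unitrM unitrX // unitrV unitrX.
rewrite /tau -(mulrA 'q) exprMn -!(mulrA ('q ^+ l)) => /mulXfI H.
exact: (mulrI UE) H.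
Qed.

(** By [xi6], multiplying by tau^l gives U(xi^(6l+e)). Its terms of degree at most l in tau vanish
    because 5l < 6l + e, so tau^l can be divided out again. *)
Lemma sect0_tauX_xi l e N : (0 < l)%N -> (5 * l + e <= N)%N ->
  sect 0 (tau ^+ l * xi ^+ e) =
  \sum_(1 <= k < N.+1) (m (6 * l + e) (l + k))%:~R * tau ^+ k.
Proof.
move=> l0 lN; apply: (@tau_cancel l).
have -> : tau ^+ l * sect 0 (tau ^+ l * xi ^+ e) = sect 0 (xi ^+ (6 * l + e)).
  rewrite -sectVM // rmorphXn /= exprD exprM -xi6 (exprMn l (subst5 tau)); congr (sect 0 _); ring.
rewrite (@sect0_xiX _ (l + N)); [|lia|lia].
rewrite (@big_cat_nat _ _ _ l.+1) //=; last lia.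
rewrite big_nat big1 ?add0r; last first.
  by move=> k kl; rewrite m_eq0 ?mul0r //; lia.
rewrite (_ : (l + N).+1 = N.+1 + l)%N; last by rewrite addSn addnC.
rewrite -[l.+1]add1n big_addn addnK mulr_sumr; apply: eq_bigr => k _.
by rewrite [RHS]mulrCA -exprD (addnC l).
Qed.

(** * Induction on the generating functions of p_{-2} *)

Definition tau_sum (j K : nat) : fps int :=
  \sum_(1 <= l < K.+1) (a j l)%:~R * tau ^+ l.

(** The exponent e selects m(6i, i+k) or m(6i+2, i+k). Since m(6i+e, i+k) is zero for k > 5i + e, a
    row supported up to K yields one supported up to 5K + 2. *)
Lemma a_step j K (e := if odd j then 0%N else 2) : (0 < j)%N ->
    (forall l, (K < l)%N -> a j l = 0) ->
  (forall l, (5 * K + 2 < l)%N -> a j.+1 l = 0) /\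
  sect 0 (tau_sum j K * xi ^+ e) = tau_sum j.+1 (5 * K + 2).
Proof.
move=> j0 aK.
have e2 : (e <= 2)%N by rewrite /e; case: odd.
have aE k : a j.+1 k = \sum_(1 <= i < K.+1) a j i * m (6 * i + e) (i + k).
  rewrite (@a_rec j k (maxn (5 * k) K)) ?leq_maxl // (@big_cat_nat _ _ _ K.+1) //=; last first.
    by rewrite ltnS leq_maxr.
  rewrite [X in _ + X]big_nat [X in _ + X]big1 ?addr0; last first.
    by move=> i /andP[Ki _]; rewrite aK ?mul0r.
  by apply: eq_bigr => i _; rewrite /e; case: odd; rewrite ?addn0.
split=> [l Kl|].
  rewrite aE big_nat big1 // => i /andP[i0 iK]; rewrite m_eq0 ?mulr0 //; lia.
rewrite /tau_sum mulr_suml raddf_sum /=.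
rewrite (eq_big_nat _ _ (F2 := fun l => \sum_(1 <= k < (5 * K + 2).+1)
     (a j l * m (6 * l + e) (l + k))%:~R * tau ^+ k)); last first.
  move=> l /andP[l0 lK]; rewrite -mulrA.
  have -> : sect 0 ((a j l)%:~R * (tau ^+ l * xi ^+ e)) = (a j l)%:~R * sect 0 (tau ^+ l * xi ^+ e).
    by rewrite !mulrzl raddfMz.
  rewrite (@sect0_tauX_xi _ _ (5 * K + 2)) //; last lia.
  by rewrite mulr_sumr; apply: eq_bigr => k _; rewrite mulrA -rmorphM.
rewrite exchange_big /=; apply: eq_bigr => k _.
by rewrite -mulr_suml aE rmorph_sum.
Qed.

Definition p2_series (j : nat) : fps int :=
  Fps (fun n => p2 (5 ^ j * n + ((if odd j then 7 else 11) * 5 ^ j + 1) %/ 12)).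

Lemma p2E : Fps p2 * E 1 ^+ 2 = 1.
Proof.
apply: fps_cvg_unique (fps_cvgM p2_cvg (fps_cvgX 2 pochq_cvg)) _.
apply: eq_fps_cvg (fps_cvg_cst 1) => N.
rewrite /pochq -prodrXl -big_split big_nat big1 // => i /andP[i0 _].
rewrite /= mulVr // unitrX // fps_unitE coefsB coefs1 coefsXn [(0 == i)%N]ltn_eqF // subr0.
Qed.

(** The factor q makes U select indices 5n+4, and 4 * 5^j + (7 * 5^j + 1)/12 = (11 * 5^(j+1) +
    1)/12. *)
Lemma p2_series_odd j : odd j ->
  sect 0 ('q * p2_series j) = 'q * p2_series j.+1.
Proof.
move=> jo; apply: fpsP => n.
rewrite -[LHS]/(coefs ('q * p2_series j) (5 * n + 0)) !coefsXM.
case: n => [|n]; first by [].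
rewrite (_ : 5 * n.+1 + 0 = (5 * n + 4).+1)%N /=; last lia.
rewrite jo /= expnS; congr p2.
by move: (5 ^ j)%N => X; lia.
Qed.

(** The factor q^3 makes U select indices 5n+2, and 2 * 5^j + (11 * 5^j + 1)/12 = (7 * 5^(j+1) +
    1)/12. *)
Lemma p2_series_even j : ~~ odd j ->
  sect 0 ('q ^+ 3 * p2_series j) = 'q * p2_series j.+1.
Proof.
move=> /negbTE jo; apply: fpsP => n.
rewrite -[LHS]/(coefs ('q ^+ 3 * p2_series j) (5 * n + 0)) coefsXnM coefsXM.
case: n => [|n]; first by [].
rewrite (_ : (5 * n.+1 + 0 < 3)%N = false) /=; last by apply/negbTE; lia.
rewrite (_ : 5 * n.+1 + 0 - 3 = 5 * n + 2)%N; last lia.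
rewrite jo /= expnS; congr p2.
by move: (5 ^ j)%N => X; lia.
Qed.

Lemma p2_series_tau j : (0 < j)%N ->
  exists2 K, forall l, (K < l)%N -> a j l = 0 &
    'q * p2_series j * E (if odd j then 5 else 1) ^+ 2 = tau_sum j K.
Proof.
have [[U1 U5] U25] := E1E5_unit.
have V1 : subst5 (E 1) = E 5 by rewrite subst5E.
have V5 : subst5 (E 5) = E 25 by rewrite subst5E.
(* Multiplying by xi^2 = q^2 E_25^2 / E_1^2 supplies the missing q^2 and trades E_1^2 for E_25^2,
   which leaves U as E_5^2. *)
have even_step i f : ~~ odd i -> 'q * p2_series i * E 1 ^+ 2 = f ->
    'q * p2_series i.+1 * E 5 ^+ 2 = sect 0 (f * xi ^+ 2).
  move=> io <-; rewrite -(p2_series_even io) mulrC -sectVM // rmorphXn /= V5.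
  congr (sect 0 _); rewrite [RHS](_ : _ = 'q * p2_series i * (xi * E 1) ^+ 2); last by ring.
  by rewrite /xi divrK //; ring.
case: j => // j _; elim: j => [|j [K aK IHj]].
  (* The first row of [a] is m(2, .): q times the first series times E_5^2 is U(xi^2) = 10 tau + 125
     tau^2. *)
  exists 2; first by case=> [|[|[|l]]] // _; rewrite /a /= nth_nil.
  have p1 : sect 0 ('q ^+ 2 * Fps p2) = 'q * p2_series 1.
    apply: fpsP => n.
    rewrite -[LHS]/(coefs ('q ^+ 2 * Fps p2) (5 * n + 0)) coefsXnM coefsXM.
    case: n => [|n]; first by [].
    rewrite (_ : (5 * n.+1 + 0 < 2)%N = false) /=; last by apply/negbTE; lia.
    by congr p2; lia.
  rewrite -p1 mulrC -sectVM // rmorphXn /= V5.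
  rewrite [X in sect 0 X](_ : _ = xi ^+ 2 * (Fps p2 * E 1 ^+ 2)); last first.
    rewrite [RHS](_ : _ = (xi * E 1) ^+ 2 * Fps p2); last by ring.
    by rewrite /xi divrK //; ring.
  rewrite p2E mulr1 (@sect0_xiX 2 2) //.
  by apply: eq_big_nat => -[|[|[|i]]].
have [aK' QK] := a_step (isT : 0 < j.+1)%N aK.
exists (5 * K + 2)%N => //; rewrite -QK -IHj; move: j.+1 => i; rewrite /=.
(* For odd i the factor E_5^2 is already a series in q^5 and leaves U as E_1^2. *)
case: (boolP (odd i)) => io /=; last exact: even_step.
rewrite expr0 mulr1 mulrC -(p2_series_odd io) -sectVM // rmorphXn /= V1.
by rewrite mulrC.
Qed.

(** The row a(j, .) has finite support, so the partial sums are eventually equal to the series; the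
    formula is [p2_series_tau] divided by q u. *)
Lemma fps_cvg_tau_series j (u := E (if odd j then 5 else 1) ^+ 2) : (0 < j)%N ->
  fps_cvg
    (fun N => \sum_(1 <= l < N.+1)
       (a j l)%:~R * 'q ^+ (l - 1) * (E 5 ^+ (6 * l) / E 1 ^+ (6 * l) / u))
    (p2_series j).
Proof.
move=> j0; have uU : u \is a GRing.unit by rewrite unitrX // E_unit //; case: odd.
have [K aK H] := p2_series_tau j0.
move=> n; exists K => N KN; congr (coefs _ n).
apply: (@mulXfI _ 1); rewrite expr1; apply: (mulIr uU); rewrite H.
rewrite /tau_sum [RHS](_ : _ = \sum_(1 <= l < N.+1) (a j l)%:~R * tau ^+ l); last first.
  rewrite [RHS](@big_cat_nat _ _ _ K.+1) //= [X in _ = _ + X]big_nat [X in _ = _ + X]big1 ?addr0 //.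
  by move=> l /andP[Kl _]; rewrite aK ?mul0r.
rewrite mulr_sumr mulr_suml; apply: eq_big_nat => l /andP[l0 _].
rewrite -!mulrA mulVr // mulr1 mulrCA; congr (_ * _).
rewrite (mulrA 'q) -{1}['q]expr1 -exprD subnKC //.
by rewrite /tau -(mulrA 'q) (exprMn l 'q) expr_div_n -!exprM.
Qed.

Theorem theorem4p1 (j : nat) (hj : (0 < j)%N) :
  fps_cvg
    (fun N => \sum_(1 <= l < N.+1)
       (a (2 * j - 1) l)%:~R * 'q ^+ (l - 1)
         * (E 5 ^+ (6 * l - 2) / E 1 ^+ (6 * l)))
    (Fps (fun n => p2 (5 ^ (2 * j - 1) * n + (7 * 5 ^ (2 * j - 1) + 1) %/ 12)))
  /\
  fps_cvg
    (fun N => \sum_(1 <= l < N.+1)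
       (a (2 * j) l)%:~R * 'q ^+ (l - 1)
         * (E 5 ^+ (6 * l) / E 1 ^+ (6 * l + 2)))
    (Fps (fun n => p2 (5 ^ (2 * j) * n + (11 * 5 ^ (2 * j) + 1) %/ 12))).
Proof.
have [[U1 U5] _] := E1E5_unit.
have oj : odd (2 * j - 1) by lia.
have ej : odd (2 * j) = false by lia.
split.
  rewrite [X in fps_cvg _ X](_ : _ = p2_series (2 * j - 1)); last by rewrite /p2_series oj.
  apply: eq_fps_cvg (fps_cvg_tau_series _) => [N|]; last by lia.
  apply: eq_big_nat => l /andP[l0 _]; congr (_ * _); rewrite oj.
  (* Valid since l >= 1 keeps 6l - 2 from truncating. *)
  have -> : (6 * l = 6 * l - 2 + 2)%N by lia.
  by rewrite {1}exprD addnK mulrAC mulrK // unitrX.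
rewrite [X in fps_cvg _ X](_ : _ = p2_series (2 * j)); last by rewrite /p2_series ej.
apply: eq_fps_cvg (fps_cvg_tau_series _) => [N|]; last by lia.
apply: eq_big_nat => l _; congr (_ * _); rewrite ej.
by rewrite -mulrA -invrM ?unitrX // -exprD addnC.
Qed.
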